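(* There is a deterministic algorithm which, given two ROABPs over a field $\mathbb F$ in $n$ variables, each of width at most $w$ and computing polynomials of individual degree at most $d$ (the two ROABPs may have different variable orders), decides whether the two ROABPs compute the same polynomial, in time polynomial in $n$, $d$ and $w$.
   Context: A polynomial $A\in\mathbb F[x_1,\dots,x_n]$ is computed by a read-once oblivious arithmetic branching program (ROABP) of width $w$ with variable order $(x_{\pi(1)},\dots,x_{\pi(n)})$ ($\pi$ a permutation of $[n]$) if $A=D_1D_2\cdots D_n$ where $D_1\in\mathbb F[x_{\pi(1)}]^{1\times w}$, $D_i\in\mathbb F[x_{\pi(i)}]^{w\times w}$ for $2\le i\le n-1$, and $D_n\in\mathbb F[x_{\pi(n)}]^{w\times 1}$; the ROABP is given explicitly by these matrices, whose entries are univariate polynomials given by their coefficient lists. Individual degree $d$ means each variable has degree at most $d$ in every monomial. Running time counts field operations. *)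

(* Defs.v *)
From HB Require Import structures.
From mathcomp Require Import all_boot all_order all_algebra all_fingroup.
From mathcomp Require Import mpoly.

Set Implicit Arguments.
Unset Strict Implicit.
Unset Printing Implicit Defensive.

Import GRing.Theory.

Local Open Scope ring_scope.

(** * Read-once oblivious arithmetic branching programs *)

(* The dimensions along the matrix product are 1, w, ..., w, 1: for [i < n]
   the [i]-th matrix has [bdim n w i] rows and [bdim n w i.+1] columns.
   For [n = 1] the only matrix is 1 x 1. *)
Definition bdim (n w k : nat) : nat :=
  if (k == 0%N) || (k == n) then 1%N else w.

Lemma bdim_last n w : bdim n w n = 1%N.
Proof. by rewrite /bdim eqxx orbT. Qed.

Record roabp (F : fieldType) (n w : nat) : Type := Roabp {
  order : 'S_n;
  layer : forall i : 'I_n, 'M[{poly F}]_(bdim n w i, bdim n w i.+1)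
}.

Section Roabp.
Variables (F : fieldType) (n w : nat) (A : roabp F n w).

Definition layer_at (i : 'I_n) :
    'M[{mpoly F[n]}]_(bdim n w i, bdim n w i.+1) :=
  map_mx (horner_alg 'X_(order A i)) (layer A i).

Fixpoint prefix_prod (k : nat) : (k <= n)%N -> 'M[{mpoly F[n]}]_(1, bdim n w k) :=
  match k with
  | 0 => fun _ => 1%:M
  | k'.+1 => fun h => prefix_prod (ltnW h) *m layer_at (Ordinal h)
  end.

Definition roabp_poly : {mpoly F[n]} :=
  castmx (erefl, bdim_last n w) (prefix_prod (leqnn n)) 0 0.

(* Coefficient of degree [k] of the entry [(r, c)] of the [i]-th matrix, and 0
   outside the range of the indices. *)
Definition roabp_coef (i r c k : nat) : F :=
  match insub i with
  | Some i' =>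
      match insub r, insub c with
      | Some r', Some c' => (layer A i' r' c')`_k
      | _, _ => 0
      end
  | None => 0
  end.

Definition roabp_order (i : nat) : nat :=
  if insub i is Some i' then nat_of_ord (order A i') else 0%N.

End Roabp.

Definition individual_degree_le (F : fieldType) (n d : nat) (p : {mpoly F[n]}) :=
  forall m : 'X_{1..n}, m \in msupp p -> forall i : 'I_n, (m i <= d)%N.

(** * Algorithms over a field *)

(* A random-access machine over a field, presented as a while-language.  It
   has natural-number variables, natural-number arrays and field arrays; an
   array cell is addressed by a list of indices, whose length is fixed by the
   program text.  The syntax does not mention the field: the only field
   constants are 0 and 1, and the only access to field elements is through the
   field operations and the equality test.

   On natural numbers only addition, truncated subtraction and comparison are
   primitive: with unit-cost multiplication, numbers of exponential bit length
   could be produced in polynomial time. *)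

Inductive iexp : Type :=
  | INum of nat
  | IVar of nat
  | IAdd of iexp & iexp
  | ISub of iexp & iexp.

Inductive fexp : Type :=
  | FZero
  | FOne
  | FCell of nat & seq iexp
  | FAdd of fexp & fexp
  | FSub of fexp & fexp
  | FMul of fexp & fexp
  | FInv of fexp.

Inductive bexp : Type :=
  | BLt of iexp & iexp
  | BIEq of iexp & iexp
  | BFEq of fexp & fexp
  | BNot of bexp
  | BAnd of bexp & bexp.

Inductive cmd : Type :=
  | Skip
  | ISet of nat & iexp
  | ILoad of nat & nat & seq iexp
  | IStore of nat & seq iexp & iexp
  | FStore of nat & seq iexp & fexp
  | Seq of cmd & cmd
  | If of bexp & cmd & cmd
  | While of bexp & cmd.

(* The cost of an expression is its number of operations, constants and memory
   accesses, on field elements and natural numbers alike. *)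

Fixpoint icost (e : iexp) : nat :=
  match e with
  | INum _ | IVar _ => 1
  | IAdd e1 e2 | ISub e1 e2 => (icost e1 + icost e2).+1
  end.

Definition ixcost (ix : seq iexp) : nat := sumn (map icost ix).

Fixpoint fcost (e : fexp) : nat :=
  match e with
  | FZero | FOne => 1
  | FCell _ ix => (ixcost ix).+1
  | FAdd e1 e2 | FSub e1 e2 | FMul e1 e2 => (fcost e1 + fcost e2).+1
  | FInv e1 => (fcost e1).+1
  end.

Fixpoint bcost (b : bexp) : nat :=
  match b with
  | BLt e1 e2 | BIEq e1 e2 => (icost e1 + icost e2).+1
  | BFEq e1 e2 => (fcost e1 + fcost e2).+1
  | BNot b1 => (bcost b1).+1
  | BAnd b1 b2 => (bcost b1 + bcost b2).+1
  end.

Section Semantics.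
Variable F : fieldType.

Record state : Type := State {
  ivar : nat -> nat;
  iarr : nat -> seq nat -> nat;
  farr : nat -> seq nat -> F
}.

Definition upd_var (m : nat -> nat) (x v : nat) : nat -> nat :=
  fun y => if y == x then v else m y.

Definition upd_arr (T : Type) (m : nat -> seq nat -> T) (a : nat) (ix : seq nat)
    (v : T) : nat -> seq nat -> T :=
  fun b jx => if (b == a) && (jx == ix) then v else m b jx.

Fixpoint ieval (s : state) (e : iexp) : nat :=
  match e with
  | INum k => k
  | IVar x => ivar s x
  | IAdd e1 e2 => (ieval s e1 + ieval s e2)%N
  | ISub e1 e2 => (ieval s e1 - ieval s e2)%N
  end.

Definition ixeval (s : state) (ix : seq iexp) : seq nat := map (ieval s) ix.

(* As [0^-1 = 0], inversion is total. *)
Fixpoint feval (s : state) (e : fexp) : F :=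
  match e with
  | FZero => 0
  | FOne => 1
  | FCell a ix => farr s a (ixeval s ix)
  | FAdd e1 e2 => feval s e1 + feval s e2
  | FSub e1 e2 => feval s e1 - feval s e2
  | FMul e1 e2 => feval s e1 * feval s e2
  | FInv e1 => (feval s e1)^-1
  end.

Fixpoint beval (s : state) (b : bexp) : bool :=
  match b with
  | BLt e1 e2 => (ieval s e1 < ieval s e2)%N
  | BIEq e1 e2 => ieval s e1 == ieval s e2
  | BFEq e1 e2 => feval s e1 == feval s e2
  | BNot b1 => ~~ beval s b1
  | BAnd b1 b2 => beval s b1 && beval s b2
  end.

(* [exec p s t s']: started in [s], the program [p] halts in [s'] after
   running for time [t]. *)
Inductive exec : cmd -> state -> nat -> state -> Prop :=
  | ExecSkip s :
      exec Skip s 1 s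
  | ExecISet s x e :
      exec (ISet x e) s (icost e).+1
        (State (upd_var (ivar s) x (ieval s e)) (iarr s) (farr s))
  | ExecILoad s x a ix :
      exec (ILoad x a ix) s (ixcost ix).+2
        (State (upd_var (ivar s) x (iarr s a (ixeval s ix))) (iarr s) (farr s))
  | ExecIStore s a ix e :
      exec (IStore a ix e) s (ixcost ix + icost e).+1
        (State (ivar s) (upd_arr (iarr s) a (ixeval s ix) (ieval s e)) (farr s))
  | ExecFStore s a ix e :
      exec (FStore a ix e) s (ixcost ix + fcost e).+1
        (State (ivar s) (iarr s) (upd_arr (farr s) a (ixeval s ix) (feval s e)))
  | ExecSeq p1 p2 s t1 s1 t2 s2 :
      exec p1 s t1 s1 -> exec p2 s1 t2 s2 ->
      exec (Seq p1 p2) s (t1 + t2) s2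
  | ExecIfTrue b p1 p2 s t s' :
      beval s b = true -> exec p1 s t s' ->
      exec (If b p1 p2) s (bcost b + t).+1 s'
  | ExecIfFalse b p1 p2 s t s' :
      beval s b = false -> exec p2 s t s' ->
      exec (If b p1 p2) s (bcost b + t).+1 s'
  | ExecWhileFalse b p s :
      beval s b = false ->
      exec (While b p) s (bcost b).+1 s
  | ExecWhileTrue b p s t1 s1 t2 s2 :
      beval s b = true -> exec p s t1 s1 -> exec (While b p) s1 t2 s2 ->
      exec (While b p) s (bcost b + t1 + t2).+1 s2.

Lemma exec_deterministic p s t1 s1 t2 s2 :
  exec p s t1 s1 -> exec p s t2 s2 -> t1 = t2 /\ s1 = s2.
Proof.
move=> H; elim: H t2 s2 => {p s t1 s1}.
- by move=> s t2 s2 H; inversion H.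
- by move=> s x e t2 s2 H; inversion H.
- by move=> s x a ix t2 s2 H; inversion H.
- by move=> s a ix e t2 s2 H; inversion H.
- by move=> s a ix e t2 s2 H; inversion H.
- move=> p1 p2 s t1 s1 t1' s1' _ IH1 _ IH2 t2 s2 H; inversion H; subst.
  by have [? ?] := IH1 _ _ H2; subst; have [? ?] := IH2 _ _ H6; subst.
- move=> b p1 p2 s t s' bT _ IH t2 s2 H; inversion H; subst; last by congruence.
  by have [? ?] := IH _ _ H7; subst.
- move=> b p1 p2 s t s' bF _ IH t2 s2 H; inversion H; subst; first by congruence.
  by have [? ?] := IH _ _ H7; subst.
- by move=> b p s bF t2 s2 H; inversion H; subst=> //; congruence.
- move=> b p s t1 s1 t1' s1' bT _ IH1 _ IH2 t2 s2 H; inversion H; subst.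
    by congruence.
  by have [? ?] := IH1 _ _ H3; subst; have [? ?] := IH2 _ _ H7; subst.
Qed.

End Semantics.

(** * Input and output conventions *)

(* Variables 0, 1, 2, 3 hold the number of variables, the degree bound and the
   two widths; integer arrays 0 and 1 hold the two variable orders, and field
   arrays 0 and 1 the coefficients of the two sequences of matrices.  All other
   cells are 0. *)
Definition input (F : fieldType) (n d wA wB : nat) (A : roabp F n wA)
    (B : roabp F n wB) : state F :=
  State
    (fun x => nth 0%N [:: n; d; wA; wB] x)
    (fun a ix =>
       match a, ix with
       | 0, [:: i] => roabp_order A i
       | 1, [:: i] => roabp_order B i
       | _, _ => 0%N
       end)
    (fun a ix =>
       match a, ix with
       | 0, [:: i; r; c; k] => roabp_coef A i r c k
       | 1, [:: i; r; c; k] => roabp_coef B i r c k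
       | _, _ => 0
       end).

Definition output (F : fieldType) (s : state F) : nat := ivar s 0.

(* [b] is the answer: the program halts with output 1 if [b] holds and 0
   otherwise, within time [T]. *)
Definition decides_within (F : fieldType) (p : cmd) (s : state F) (b : bool)
    (T : nat) : Prop :=
  exists (t : nat) (s' : state F),
    [/\ exec p s t s', output s' = b & (t <= T)%N].

(* Main.v *)
Require Import Defs.
From mathcomp Require Import all_boot all_order all_algebra all_fingroup.
From mathcomp Require Import mpoly.
From mathcomp Require Import zify ring.

(** Write [A_a] for the partial evaluation of the first polynomial at a monomial
    [a] in its first [k] variables.  For each [k] one keeps at most [w]
    monomials whose prefix vectors in the first program span all prefix
    vectors; every one-step extension [A_(a,e)] is then an explicit linear
    combination of the [A_b] at level [k+1].  If the two polynomials agree, the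
    same relations hold for the [B_a]; conversely, if they all hold and the
    constants at level [n] agree, backward induction on [k] gives [A = B].  A
    relation between the [B_a] says that a linear combination of restrictions
    of the second program vanishes.  This combination is again an ROABP, in
    the order of [B], with a direct sum of blocks as its state space, and it is
    tested by propagating a spanning set of its prefix vectors.

    Spanning sets come without elimination: for the vectors met so far one keeps
    matrices with [P + R * Bas = 1], where [P] annihilates these vectors.  A new
    vector [v] with [(v P)_j <> 0] enters row [j] of [Bas] by a rank-one update,
    and a vector killed by [P] equals [(v R) Bas].

    Monomials are represented by substitution tables [G v e e'], so that fixing
    a variable is the operation [fixG]. *)

Set Implicit Arguments.
Unset Strict Implicit.
Unset Printing Implicit Defensive.

Import GRing.Theory.

Local Open Scope ring_scope.


(** The two orders are unrelated: a prefix of the first is scattered over the second, so no prefix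
    vector of the second program stands for [B_a]. But fixing an exponent only changes which
    coefficient of a layer is read, so every [B_a] keeps the layers and the order of the second
    program. A relation thus joins at most [w + 1] ROABPs in one common order, of total width at
    most [(w + 1) w], and there are at most [n (d + 1) w] relations. Slots are indexed by the
    coordinates themselves, hence a spanning set cannot outgrow the dimension, and no rank is ever
    counted. A free slot holds the zero vector and the zero table, which stand for the zero
    polynomial; invariants can therefore speak of all slots alike. The machine has general [While]
    loops. The algorithm is written instead in a language whose loops and sums run up to one of the
    variables 0 to 6, which programs cannot assign. Termination is then built in, correctness
    concerns a total function [run], and a polynomial time bound is read off the syntax. *)

(** * A total loop language above the machine *)

Inductive fop : Type := OAdd | OSub | OMul.

(** Sums and case distinctions on indices are terms, not commands: the value of a matrix formula is
    then a big operator, to which the usual summation lemmas apply directly. *)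
Inductive fterm : Type :=
  | TZero
  | TOne
  | TCell of nat & seq iexp
  | TOp of fop & fterm & fterm
  | TInv of fterm
  | TIf of iexp & iexp & fterm & fterm
  | TSum of nat & nat & fterm.

Inductive prog : Type :=
  | PSet of nat & iexp
  | PLoad of nat & nat & seq iexp
  | PStore of nat & seq iexp & fterm
  | PSeq of prog & prog
  | PIf of fterm & prog
  | PFor of nat & nat & prog.

Section Run.
Variable F : fieldType.
Implicit Type s : state F.

Definition setv s x v : state F := State (upd_var (ivar s) x v) (iarr s) (farr s).

Definition fopE (o : fop) : F -> F -> F :=
  match o with
  | OAdd => fun a b => a + b
  | OSub => fun a b => a - b
  | OMul => fun a b => a * b
  end.

Fixpoint teval s (t : fterm) : F :=
  match t with
  | TZero => 0
  | TOne => 1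
  | TCell a ix => farr s a (ixeval s ix)
  | TOp o t1 t2 => fopE o (teval s t1) (teval s t2)
  | TInv t1 => (teval s t1)^-1
  | TIf e1 e2 t1 t2 => if ieval s e1 == ieval s e2 then teval s t1 else teval s t2
  | TSum x N t1 => \sum_(j < ivar s N) teval (setv s x j) t1
  end.

Definition for_run (f : state F -> state F) (x n : nat) s : state F :=
  foldl (fun s1 i => f (setv s1 x i)) s (iota 0 n).

(** After a loop the counter is set to the bound, the value with which the compiled [While] stops;
    so [run] and the machine also agree on loop counters. *)
Fixpoint run (p : prog) s : state F :=
  match p with
  | PSet x e => setv s x (ieval s e)
  | PLoad x a ix => setv s x (iarr s a (ixeval s ix))
  | PStore a ix t =>
      State (ivar s) (iarr s) (upd_arr (farr s) a (ixeval s ix) (teval s t))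
  | PSeq p1 p2 => run p2 (run p1 s)
  | PIf t p1 => if teval s t == 0 then s else run p1 s
  | PFor x N p1 => setv (for_run (run p1) x (ivar s N) s) x (ivar s N)
  end.

Lemma for_runS f x n s : for_run f x n.+1 s = f (setv (for_run f x n s) x n).
Proof. by rewrite /for_run -addn1 iotaD foldl_cat. Qed.

End Run.

(** * Static conditions *)

Fixpoint iin (V : pred nat) (e : iexp) : bool :=
  match e with
  | INum _ => true
  | IVar x => V x
  | IAdd e1 e2 | ISub e1 e2 => iin V e1 && iin V e2
  end.

(* The free variables of [t] are in [V] and the arrays that it reads in [R]. *)
Fixpoint tin (V R : pred nat) (t : fterm) : bool :=
  match t with
  | TZero | TOne => true
  | TCell a ix => R a && all (iin V) ix
  | TOp _ t1 t2 => tin V R t1 && tin V R t2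
  | TInv t1 => tin V R t1
  | TIf e1 e2 t1 t2 => [&& iin V e1, iin V e2, tin V R t1 & tin V R t2]
  | TSum x N t1 => V N && tin (fun y => (y == x) || V y) R t1
  end.

Lemma eq_iin (V V' : pred nat) e : V =1 V' -> iin V e -> iin V' e.
Proof.
move=> E; elim: e => [j|y|e1 I1 e2 I2|e1 I1 e2 I2] //=; rewrite ?E //.
  by case/andP=> /I1 -> /I2.
by case/andP=> /I1 -> /I2.
Qed.

Lemma eq_tin (V V' R : pred nat) t : V =1 V' -> tin V R t -> tin V' R t.
Proof.
elim: t V V' => //=.
- by move=> a ix V V' E /andP[-> /=]; apply: sub_all => e; apply: eq_iin.
- by move=> _ t1 I1 t2 I2 V V' E /andP[/(I1 _ _ E) -> /(I2 _ _ E)].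
- move=> e1 e2 t1 I1 t2 I2 V V' E.
  by case/and4P=> /(eq_iin E) -> /(eq_iin E) -> /(I1 _ _ E) -> /(I2 _ _ E).
- move=> y N t1 I1 V V' E /andP[]; rewrite E => -> /=; apply: I1 => z.
  by rewrite E.
Qed.

(* Variables below 7 are read-only loop bounds, those from 100 on are the
   summation variables, and array 100 is reserved for intermediate values. *)
Definition uservar (bs : seq nat) : pred nat := fun x => (x < 100)%N || (x \in bs).

Lemma uservar_bound bs x : (x < 7)%N -> uservar bs x.
Proof. by rewrite /uservar => h; rewrite (ltn_trans h). Qed.

Definition userarr : pred nat := fun a => (a < 100)%N.

Fixpoint tbind (bs : seq nat) (t : fterm) : bool :=
  match t with
  | TZero | TOne | TCell _ _ => true
  | TOp _ t1 t2 => tbind bs t1 && tbind bs t2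
  | TInv t1 => tbind bs t1
  | TIf e1 e2 t1 t2 => tbind bs t1 && tbind bs t2
  | TSum x N t1 => [&& (100 <= x)%N, x \notin bs, (N < 7)%N & tbind (x :: bs) t1]
  end.

Definition twf (t : fterm) := tin (uservar [::]) userarr t && tbind [::] t.

Fixpoint modv (p : prog) : seq nat :=
  match p with
  | PSet x _ | PLoad x _ _ => [:: x]
  | PStore _ _ _ => [::]
  | PSeq p1 p2 => modv p1 ++ modv p2
  | PIf _ p1 => modv p1
  | PFor x _ p1 => x :: modv p1
  end.

Fixpoint moda (p : prog) : seq nat :=
  match p with
  | PSet _ _ | PLoad _ _ _ => [::]
  | PStore a _ _ => [:: a]
  | PSeq p1 p2 => moda p1 ++ moda p2
  | PIf _ p1 => moda p1
  | PFor _ _ p1 => moda p1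
  end.

Definition assignable (x : nat) := (7 <= x < 100)%N.

(** Assignable variables start at 7, so no program changes a loop bound, and a loop body leaves its
    own counter alone. The number of rounds is therefore known on entry to a loop. *)
Fixpoint pwf (p : prog) : bool :=
  match p with
  | PSet x e => assignable x && iin (uservar [::]) e
  | PLoad x a ix => assignable x && all (iin (uservar [::])) ix
  | PStore a ix t => [&& userarr a, all (iin (uservar [::])) ix & twf t]
  | PSeq p1 p2 => pwf p1 && pwf p2
  | PIf t p1 => twf t && pwf p1
  | PFor x N p1 => [&& assignable x, (N < 7)%N, x \notin modv p1 & pwf p1]
  end.

Definition eqon (V : pred nat) (f g : nat -> nat) : Prop := forall x, V x -> f x = g x.

Section Frame.
Variable F : fieldType.
Implicit Type s : state F.

Lemma setv_same s x v : ivar (setv s x v) x = v.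
Proof. by rewrite /= /upd_var eqxx. Qed.

Lemma setv_other s x v y : y != x -> ivar (setv s x v) y = ivar s y.
Proof. by rewrite /= /upd_var => /negbTE ->. Qed.

Lemma ieval_ext (V : pred nat) s s' e :
  iin V e -> eqon V (ivar s') (ivar s) -> ieval s' e = ieval s e.
Proof.
move=> + E; elim: e => [k|x|e1 IH1 e2 IH2|e1 IH1 e2 IH2] //=; first exact: E.
  by case/andP=> /IH1 -> /IH2 ->.
by case/andP=> /IH1 -> /IH2 ->.
Qed.

Lemma ixeval_ext (V : pred nat) s s' ix :
  all (iin V) ix -> eqon V (ivar s') (ivar s) -> ixeval s' ix = ixeval s ix.
Proof.
move=> + E; elim: ix => //= e ix IH /andP[he hix].
by rewrite (ieval_ext he E) IH.
Qed.

Lemma teval_ext (V R : pred nat) s s' t :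
  tin V R t -> eqon V (ivar s') (ivar s) ->
  (forall a ix, R a -> farr s' a ix = farr s a ix) -> teval s' t = teval s t.
Proof.
elim: t V s s' => //=.
- by move=> a ix V s s' /andP[ha hix] E Ea; rewrite Ea // (ixeval_ext hix E).
- move=> o t1 IH1 t2 IH2 V s s' /andP[h1 h2] E Ea.
  by rewrite (IH1 V s s') // (IH2 V s s').
- by move=> t1 IH1 V s s' h1 E Ea; rewrite (IH1 V s s').
- move=> e1 e2 t1 IH1 t2 IH2 V s s' /and4P[he1 he2 h1 h2] E Ea.
  rewrite (ieval_ext he1 E) (ieval_ext he2 E).
  by rewrite (IH1 V s s') // (IH2 V s s').
- move=> x N t1 IH1 V s s' /andP[hN h1] E Ea.
  rewrite E //; apply: eq_bigr => j _; apply: IH1 h1 _ _ => //= y.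
  by rewrite /upd_var; case: eqP => //= _ /E.
Qed.

Lemma run_ivar p s x : x \notin modv p -> ivar (run p s) x = ivar s x.
Proof.
elim: p s => //=.
- by move=> y e s; rewrite inE /upd_var => /negbTE ->.
- by move=> y a ix s; rewrite inE /upd_var => /negbTE ->.
- by move=> p1 IH1 p2 IH2 s; rewrite mem_cat negb_or => /andP[/IH1 h1 /IH2 ->].
- by move=> t p IH s /IH h; case: ifP.
- move=> y N p IH s; rewrite inE negb_or => /andP[/negbTE hy hx].
  rewrite /upd_var hy; elim: (ivar s N) => // k IHk.
  by rewrite for_runS IH // /= /upd_var hy.
Qed.

Lemma run_farr p s a : a \notin moda p -> farr (run p s) a = farr s a.
Proof.
elim: p s => //=.
- by move=> b ix t s; rewrite inE /upd_arr => /negbTE ->.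
- by move=> p1 IH1 p2 IH2 s; rewrite mem_cat negb_or => /andP[/IH1 h1 /IH2 ->].
- by move=> t p IH s /IH h; case: ifP.
- move=> y N p IH s hx.
  elim: (ivar s N) => // k IHk.
  by rewrite for_runS IH.
Qed.

Lemma run_iarr p s : iarr (run p s) = iarr s.
Proof.
elim: p s => //=.
- by move=> p1 IH1 p2 IH2 s; rewrite IH2.
- by move=> t p IH s; case: ifP.
- move=> y N p IH s.
  elim: (ivar s N) => // k IHk.
  by rewrite for_runS IH.
Qed.

Lemma pwf_modv p x : pwf p -> x \in modv p -> assignable x.
Proof.
elim: p => //=.
- by move=> y e /andP[h _]; rewrite inE => /eqP ->.
- by move=> y a ix /andP[h _]; rewrite inE => /eqP ->.
- move=> p1 IH1 p2 IH2 /andP[/IH1 h1 /IH2 h2]; rewrite mem_cat.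
  by case/orP.
- by move=> t p IH /andP[_].
- move=> y N p IH /and4P[hy _ _ /IH h]; rewrite inE.
  by case/predU1P => [->|].
Qed.

Lemma run_bound p s x : pwf p -> (x < 7)%N -> ivar (run p s) x = ivar s x.
Proof.
move=> hp hx; apply: run_ivar; apply/negP=> /(pwf_modv hp).
by rewrite /assignable leqNgt hx.
Qed.

End Frame.

(** * Compilation *)

Definition scell (k : nat) : fexp := FCell 100 [:: INum k].
Definition sset (k : nat) (e : fexp) : cmd := FStore 100 [:: INum k] e.

Definition cfor (x N : nat) (c : cmd) : cmd :=
  Seq (ISet x (INum 0))
    (While (BLt (IVar x) (IVar N)) (Seq c (ISet x (IAdd (IVar x) (INum 1))))).

Definition cop (o : fop) : fexp -> fexp -> fexp :=
  match o with OAdd => FAdd | OSub => FSub | OMul => FMul end.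

(** Array 100 is an evaluation stack: the value of [t] goes to cell [k], subterms use the cells from
    [k] on, and the cells below [k] survive. The depth is fixed by the syntax, so constant addresses
    suffice. *)
Fixpoint cterm (t : fterm) (k : nat) : cmd :=
  match t with
  | TZero => sset k FZero
  | TOne => sset k FOne
  | TCell a ix => sset k (FCell a ix)
  | TOp o t1 t2 =>
      Seq (cterm t1 k) (Seq (cterm t2 k.+1) (sset k (cop o (scell k) (scell k.+1))))
  | TInv t1 => Seq (cterm t1 k) (sset k (FInv (scell k)))
  | TIf e1 e2 t1 t2 => If (BIEq e1 e2) (cterm t1 k) (cterm t2 k)
  | TSum x N t1 =>
      Seq (sset k FZero)
        (cfor x N (Seq (cterm t1 k.+1) (sset k (FAdd (scell k) (scell k.+1)))))
  end.

Fixpoint cprog (p : prog) : cmd :=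
  match p with
  | PSet x e => ISet x e
  | PLoad x a ix => ILoad x a ix
  | PStore a ix t => Seq (cterm t 0) (FStore a ix (scell 0))
  | PSeq p1 p2 => Seq (cprog p1) (cprog p2)
  | PIf t p1 => Seq (cterm t 0) (If (BFEq (scell 0) FZero) Skip (cprog p1))
  | PFor x N p1 => cfor x N (cprog p1)
  end.

(** Per round: 3 for the test, 1 for the [While] step, 4 for the increment. Once: 2 for the initial
    assignment and 4 for the failing test. *)
Definition for_cost (C M : nat) : nat := ((C + 8) * M + 6)%N.

Fixpoint tcost (t : fterm) (M : nat) : nat :=
  match t with
  | TZero | TOne => 3
  | TCell a ix => (ixcost ix + 3)%N
  | TOp o t1 t2 => (tcost t1 M + (tcost t2 M + 7))%N
  | TInv t1 => (tcost t1 M + 5)%N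
  | TIf e1 e2 t1 t2 => (icost e1 + icost e2 + 2 + (tcost t1 M + tcost t2 M))%N
  | TSum x N t1 => (3 + for_cost (tcost t1 M + 7) M)%N
  end.

Fixpoint pcost (p : prog) (M : nat) : nat :=
  match p with
  | PSet x e => (icost e + 1)%N
  | PLoad x a ix => (ixcost ix + 2)%N
  | PStore a ix t => (tcost t M + (ixcost ix + 3))%N
  | PSeq p1 p2 => (pcost p1 M + pcost p2 M)%N
  | PIf t p1 => (tcost t M + (pcost p1 M + 7))%N
  | PFor x N p1 => for_cost (pcost p1 M) M
  end.

Section Compile.
Variable F : fieldType.
Implicit Type s : state F.

Lemma exec_cfor (Inv : nat -> state F -> Prop) x N c C n0 s :
  (forall i s1, Inv i s1 -> ivar s1 x = i /\ ivar s1 N = n0) ->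
  (forall i s1, (i < n0)%N -> Inv i s1 -> exists t s2,
     [/\ exec c s1 t s2, (t <= C)%N, ivar s2 x = i & Inv i.+1 (setv s2 x i.+1)]) ->
  Inv 0%N (setv s x 0) ->
  exists t s', [/\ exec (cfor x N c) s t s', (t <= for_cost C n0)%N & Inv n0 s'].
Proof.
move=> HI Hb H0.
suff W : forall j i s1, (i + j = n0)%N -> Inv i s1 -> exists t s',
    [/\ exec (While (BLt (IVar x) (IVar N))
          (Seq c (ISet x (IAdd (IVar x) (INum 1))))) s1 t s',
        (t <= (C + 8) * j + 4)%N & Inv n0 s'].
  have [t [s' [He Ht Hs]]] := W n0 0%N _ (add0n _) H0.
  exists (2 + t)%N, s'; split=> //.
    by apply: ExecSeq He; apply: ExecISet.
  by rewrite /for_cost; lia.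
elim=> [|j IH] i s1 Hij Hi; have [hx hN] := HI _ _ Hi.
  exists 4, s1; split; [|lia|by rewrite -Hij addn0].
  by apply: ExecWhileFalse; rewrite /= hx hN -Hij addn0 ltnn.
have hi : (i < n0)%N by lia.
have [t1 [s2 [He Ht hx2 Hs2]]] := Hb _ _ hi Hi.
have Hij' : (i.+1 + j = n0)%N by lia.
have [t2 [s3 [He2 Ht2 Hs3]]] := IH i.+1 _ Hij' Hs2.
exists (3 + (t1 + 4) + t2).+1, s3; split=> //; last by lia.
apply: (@ExecWhileTrue _ (BLt (IVar x) (IVar N))) He2.
  by rewrite /= hx hN hi.
apply: ExecSeq He _.
have -> : i.+1 = ieval s2 (IAdd (IVar x) (INum 1)) by rewrite /= hx2 addn1.
exact: ExecISet.
Qed.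

(** The stack lives at one-element addresses of array 100. All other addresses count as kept, and so
    do the stack cells below [k], which are in use. *)
Definition keeps (k : nat) (a : nat) (ix : seq nat) : bool :=
  (a != 100%N) || (if ix is [:: j] then (j < k)%N else true).

Definition agree (bs : seq nat) (k : nat) s s' : Prop :=
  [/\ eqon (uservar bs) (ivar s') (ivar s), iarr s' = iarr s &
      forall a ix, keeps k a ix -> farr s' a ix = farr s a ix].

Lemma agree_trans bs k s1 s2 s3 : agree bs k s1 s2 -> agree bs k s2 s3 -> agree bs k s1 s3.
Proof.
case=> v1 i1 f1 [v2 i2 f2]; split; last by move=> a ix h; rewrite f2 ?f1.
  by move=> x hx; rewrite v2 // v1.
by rewrite i2.
Qed.

Lemma agreeW bs k s s' : agree bs k.+1 s s' -> agree bs k s s'.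
Proof.
case=> v i f; split=> // a ix h; apply: f; move: h; rewrite /keeps.
by case: (a != 100%N) => //=; case: ix => // j [] //; lia.
Qed.

Lemma keeps_user k a ix : userarr a -> keeps k a ix.
Proof. by rewrite /userarr /keeps; case: eqP => // ->. Qed.

Lemma teval_agree bs k s s' t :
  tin (uservar bs) userarr t -> agree bs k s s' -> teval s' t = teval s t.
Proof.
by move=> ht [v _ f]; apply: (teval_ext ht v) => a ix h; apply: f; apply: keeps_user.
Qed.

Definition put s k (v : F) : state F :=
  State (ivar s) (iarr s) (upd_arr (farr s) 100 [:: k] v).

Lemma exec_sset s k e : exec (sset k e) s (fcost e + 2) (put s k (feval s e)).
Proof.
have -> : (fcost e + 2 = (ixcost [:: INum k] + fcost e).+1)%N by rewrite addn2.
exact: ExecFStore.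
Qed.

Lemma put_get s k v : farr (put s k v) 100 [:: k] = v.
Proof. by rewrite /= /upd_arr !eqxx. Qed.

Lemma agree_put bs s k v : agree bs k s (put s k v).
Proof.
split=> // a ix; rewrite /keeps /= /upd_arr.
case: eqP => //= ->; case: eqP => // ->; by rewrite ltnn.
Qed.

Lemma agree_get bs k s s' : agree bs k.+1 s s' -> farr s' 100 [:: k] = farr s 100 [:: k].
Proof. by case=> _ _; apply; rewrite /keeps /=. Qed.

Lemma ctermP t bs k s M :
  tin (uservar bs) userarr t -> tbind bs t ->
  (forall x, (x < 7)%N -> (ivar s x <= M)%N) ->
  exists T s', [/\ exec (cterm t k) s T s', (T <= tcost t M)%N,
    farr s' 100 [:: k] = teval s t & agree bs k s s'].
Proof.
elim: t bs k s => /=.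
- move=> bs k s _ _ _; do 2 eexists; split; first exact: exec_sset; first by [].
    exact: put_get.
  exact: agree_put.
- move=> bs k s _ _ _; do 2 eexists; split; first exact: exec_sset; first by [].
    exact: put_get.
  exact: agree_put.
- move=> a ix bs k s _ _ _; do 2 eexists; split; first exact: exec_sset.
  - by rewrite /=; lia.
  - exact: put_get.
  - exact: agree_put.
- move=> o t1 IH1 t2 IH2 bs k s /andP[i1 i2] /andP[b1 b2] HM.
  have [T1 [s1 [E1 C1 V1 A1]]] := IH1 bs k s i1 b1 HM.
  have HM1 x : (x < 7)%N -> (ivar s1 x <= M)%N.
    move=> hx; case: A1 => v _ _; rewrite v; [exact: HM|exact: uservar_bound].
  have [T2 [s2 [E2 C2 V2 A2]]] := IH2 bs k.+1 s1 i2 b2 HM1.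
  do 2 eexists; split.
  + apply: ExecSeq E1 _; apply: ExecSeq E2 _; exact: exec_sset.
  + have -> : fcost (cop o (scell k) (scell k.+1)) = 5 by case: (o).
    lia.
  + rewrite put_get; have := agree_get A2; rewrite V1 => V1'.
    rewrite (teval_agree i2 A1) in V2.
    by case: (o); rewrite /= V1' V2.
  + apply: agree_trans A1 _; apply: agree_trans (agreeW A2) _; exact: agree_put.
- move=> t1 IH1 bs k s i1 b1 HM.
  have [T1 [s1 [E1 C1 V1 A1]]] := IH1 bs k s i1 b1 HM.
  do 2 eexists; split.
  + apply: ExecSeq E1 _; exact: exec_sset.
  + by rewrite /= /ixcost /=; lia.
  + by rewrite put_get /= V1.
  + apply: agree_trans A1 _; exact: agree_put.
- move=> e1 e2 t1 IH1 t2 IH2 bs k s /and4P[_ _ i1 i2] /andP[b1 b2] HM.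
  case: ifP => hb.
  + have [T1 [s1 [E1 C1 V1 A1]]] := IH1 bs k s i1 b1 HM.
    do 2 eexists; split; [exact: ExecIfTrue E1 | rewrite /=; lia | done | done].
  + have [T1 [s1 [E1 C1 V1 A1]]] := IH2 bs k s i2 b2 HM.
    do 2 eexists; split; [exact: ExecIfFalse E1 | rewrite /=; lia | done | done].
- move=> x N t IH bs k s /andP[hN i1] /and4P[hx hxb hN7 b1] HM.
  have i1' : tin (uservar (x :: bs)) userarr t.
    apply: eq_tin i1 => y; rewrite /uservar inE; by case: (y == x); rewrite ?orbT.
  have xN : N != x by apply: contraTneq hN7 => ->; lia.
  (* The compiled sum overwrites [x] and never restores it. This is harmless because [x] lies
     outside [uservar bs], the variables on which [agree bs] insists. *)
  have xu : ~~ uservar bs x by rewrite /uservar negb_or hxb -leqNgt hx.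
  have nin y : uservar bs y -> y != x by move=> hy; apply: contraNneq xu => <-.
  pose Inv j s1 := [/\ agree bs k s s1, ivar s1 x = j &
    farr s1 100 [:: k] = \sum_(i < j) teval (setv s x i) t].
  have Ns s1 : agree bs k s s1 -> ivar s1 N = ivar s N.
    by case=> v _ _; rewrite v //; apply: uservar_bound.
  have := @exec_cfor Inv x N
    (Seq (cterm t k.+1) (sset k (FAdd (scell k) (scell k.+1))))
    (tcost t M + 7)%N (ivar s N) (put s k 0).
  case.
  + by move=> i s1 [/Ns A -> _].
  + move=> i s1 hi [A1 hi1 V1].
    have HM1 y : (y < 7)%N -> (ivar s1 y <= M)%N.
      move=> hy; case: A1 => v _ _; rewrite v; [exact: HM|exact: uservar_bound].
    have [T2 [s2 [E2 C2 V2 A2]]] := IH (x :: bs) k.+1 s1 i1' b1 HM1.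
    have x2 : ivar s2 x = i.
      by case: A2 => v _ _; rewrite v // /uservar mem_head orbT.
    have A12 : agree bs k.+1 s1 s2.
      case: A2 => v2 j2 f2; split=> // y hy; apply: v2; move: hy.
      by rewrite /uservar inE; case: (y < 100)%N; case: (y == x); rewrite ?orbT.
    do 2 eexists; split.
    * apply: ExecSeq E2 _; exact: exec_sset.
    * rewrite /= /ixcost /=; lia.
    * by [].
    * split; last 1 first.
      - rewrite [LHS]put_get /= (agree_get A12) V1 V2 big_ord_recr /=; congr (_ + _).
        apply: teval_ext i1' _ _.
          move=> y; rewrite /uservar inE /= /upd_var; case: eqP => [->|_ /=] //.
          by case: A1 => [h _ _] hy; apply: h.
        move=> a ix ha; case: A1 => [_ _ h]; apply: h; exact: keeps_user.
      - apply: agree_trans A1 _; apply: agree_trans (agreeW A12) _.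
        case: (agree_put bs s2 k (feval s2 (FAdd (scell k) (scell k.+1)))) => v j f.
        split=> // y hy; rewrite setv_other ?v //; exact: nin.
      - exact: setv_same.
  + split; last 1 first.
    * by rewrite [LHS]put_get big_ord0.
    * case: (agree_put bs s k 0) => v j f.
      split=> // y hy; rewrite setv_other ?v //; exact: nin.
    * exact: setv_same.
  move=> T [s' [E C [A _ V]]].
  exists (3 + T)%N, s'; split=> //.
  + apply: ExecSeq E; exact: exec_sset.
  + have := HM N hN7; move: C; rewrite /for_cost; nia.
Qed.

(** The summation variables and the stack are left out: compiled code changes them, whereas [run]
    evaluates a term without side effects. *)
Definition sim s s' : Prop :=
  [/\ eqon (uservar [::]) (ivar s') (ivar s), iarr s' = iarr s &
      forall a ix, userarr a -> farr s' a ix = farr s a ix].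

Lemma sim_agree s s' s'' : sim s s' -> agree [::] 0 s' s'' -> sim s s''.
Proof.
case=> v1 i1 f1 [v2 i2 f2]; split; last by move=> a ix h; rewrite f2 ?f1 ?keeps_user.
  by move=> x hx; rewrite v2 // v1.
by rewrite i2.
Qed.

Lemma sim_setv s s' x v : sim s s' -> sim (setv s x v) (setv s' x v).
Proof.
by case=> v1 i1 f1; split=> // y hy; rewrite /= /upd_var; case: eqP => // _; apply: v1.
Qed.

Lemma cprogP p s s' M :
  pwf p -> sim s s' -> (forall x, (x < 7)%N -> (ivar s x <= M)%N) ->
  exists T s'', [/\ exec (cprog p) s' T s'', (T <= pcost p M)%N & sim (run p s) s''].
Proof.
have HM' s1 s1' : sim s1 s1' -> (forall x, (x < 7)%N -> (ivar s1 x <= M)%N) ->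
    forall x, (x < 7)%N -> (ivar s1' x <= M)%N.
  case=> v1 _ _ H x hx; rewrite v1; first exact: H.
  exact: uservar_bound.
elim: p s s' => /=.
- move=> x e s s' /andP[_ he] S HM; do 2 eexists; split; first exact: ExecISet.
    by rewrite addn1.
  have -> : ieval s e = ieval s' e by case: S => v _ _; rewrite (ieval_ext he v).
  exact: sim_setv.
- move=> x a ix s s' /andP[_ he] S HM; do 2 eexists; split; first exact: ExecILoad.
    by rewrite addn2.
  have -> : iarr s a (ixeval s ix) = iarr s' a (ixeval s' ix).
    by case: S => v j _; rewrite (ixeval_ext he v) j.
  exact: sim_setv.
- move=> a ix t s s' /and3P[ha hix /andP[i1 b1]] S HM.
  have [T1 [s1 [E1 C1 V1 A1]]] := @ctermP t [::] 0 s' M i1 b1 (HM' _ _ S HM).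
  have S1 := sim_agree S A1.
  do 2 eexists; split.
  + apply: ExecSeq E1 _; exact: ExecFStore.
  + rewrite /= {2}/ixcost /=; lia.
  + case: S1 => v j f; split=> //= b jx hb; rewrite /upd_arr (ixeval_ext hix v).
    case: ifP => // _; last exact: f.
    rewrite /= V1; case: S => v0 _ f0; exact: teval_ext i1 v0 f0.
- move=> p1 IH1 p2 IH2 s s' /andP[w1 w2] S HM.
  have [T1 [s1 [E1 C1 S1]]] := IH1 _ _ w1 S HM.
  have HM1 x : (x < 7)%N -> (ivar (run p1 s) x <= M)%N.
    by move=> hx; rewrite run_bound // HM.
  have [T2 [s2 [E2 C2 S2]]] := IH2 _ _ w2 S1 HM1.
  do 2 eexists; split; [exact: ExecSeq E1 E2 | lia | done].
- move=> t p1 IH1 s s' /andP[/andP[i1 b1] w1] S HM.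
  have [T1 [s1 [E1 C1 V1 A1]]] := @ctermP t [::] 0 s' M i1 b1 (HM' _ _ S HM).
  have S1 := sim_agree S A1.
  have V : feval s1 (scell 0) = teval s t.
    rewrite /= V1; case: S => v0 _ f0; exact: teval_ext i1 v0 f0.
  case: ifP => hb.
  + do 2 eexists; split.
    * apply: ExecSeq E1 _; apply: ExecIfTrue; last exact: ExecSkip.
      by rewrite [beval _ _]/(feval s1 (scell 0) == 0) V.
    * rewrite /= /ixcost /=; lia.
    * done.
  + have [T2 [s2 [E2 C2 S2]]] := IH1 _ _ w1 S1 HM.
    do 2 eexists; split.
    * apply: ExecSeq E1 _; apply: ExecIfFalse E2.
      by rewrite [beval _ _]/(feval s1 (scell 0) == 0) V.
    * rewrite /= /ixcost /=; lia.
    * done.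
- move=> x N p IH s s' /and4P[hx hN hxm w] S HM.
  have xN : N != x by apply: contraTneq hN => ->; move: hx; rewrite /assignable; lia.
  have cst i y : (y < 7)%N -> ivar (for_run (run p) x i s) y = ivar s y.
    move=> hy; elim: i => // i IHi; rewrite for_runS run_bound // setv_other //.
    by apply: contraTneq hy => ->; move: hx; rewrite /assignable; lia.
  have uN y : (y < 7)%N -> uservar [::] y by move=> h; rewrite /uservar (ltn_trans h).
  pose Inv i s1 := sim (setv (for_run (run p) x i s) x i) s1.
  have := @exec_cfor Inv x N (cprog p) (pcost p M) (ivar s N) s'.
  case.
  + move=> i s1 [v _ _]; rewrite (v N (uN N hN)) setv_other // cst // v.
      by rewrite setv_same.
    by move: hx; rewrite /uservar => /andP[_ ->].
  + move=> i s1 hi Si.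
    have [|T1 [s2 [E1 C1 S1]]] := IH _ _ w Si.
      move=> y hy; rewrite setv_other ?cst ?HM //.
      by apply: contraTneq hy => ->; move: hx; rewrite /assignable; lia.
    exists T1, s2; split=> //.
      case: S1 => v _ _; rewrite v; first by rewrite run_ivar // setv_same.
      by move: hx; rewrite /uservar => /andP[_ ->].
    rewrite /Inv for_runS; exact: sim_setv.
  + exact: sim_setv.
  move=> T [s1 [E C S1]]; exists T, s1; split=> //.
  have := HM N hN; move: C; rewrite /for_cost; nia.
Qed.

End Compile.

(** * Polynomial bounds on the cost functions *)

Definition poly_bounded (f : nat -> nat) : Prop :=
  exists c, forall M, (f M <= c * M.+1 ^ c)%N.

Lemma poly_bounded_const k : poly_bounded (fun=> k).
Proof. by exists k => M; rewrite leq_pmulr // expn_gt0. Qed.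

Lemma poly_bounded_id : poly_bounded id.
Proof. by exists 1%N => M; rewrite mul1n expn1. Qed.

Lemma poly_boundedD f g : poly_bounded f -> poly_bounded g ->
  poly_bounded (fun M => f M + g M)%N.
Proof.
case=> a ha [b hb]; exists (a + b)%N => M; rewrite mulnDl.
by apply: leq_add; [apply: leq_trans (ha M) _|apply: leq_trans (hb M) _];
  rewrite leq_mul2l leq_pexp2l ?orbT ?leq_addr ?leq_addl.
Qed.

Lemma poly_boundedM f g : poly_bounded f -> poly_bounded g ->
  poly_bounded (fun M => f M * g M)%N.
Proof.
(* The summand [a * b] pays for the product of the factors, [a + b] for the sum of the exponents. *)
case=> a ha [b hb]; exists (a + b + a * b)%N => M.
apply: leq_trans (leq_mul (ha M) (hb M)) _; rewrite mulnACA -expnD.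
by apply: leq_mul; rewrite ?leq_addl // leq_pexp2l ?leq_addr.
Qed.

Lemma poly_bounded_for f : poly_bounded f -> poly_bounded (fun M => for_cost (f M) M).
Proof.
move=> hf; rewrite /for_cost.
apply: (@poly_boundedD (fun M => (f M + 8) * M)%N); last exact: poly_bounded_const.
apply: (@poly_boundedM (fun M => f M + 8)%N id); last exact: poly_bounded_id.
by apply: poly_boundedD => //; apply: poly_bounded_const.
Qed.

Lemma poly_bounded_tcost t : poly_bounded (tcost t).
Proof.
elim: t => /=; try by move=> *; apply: poly_bounded_const.
- move=> o t1 IH1 t2 IH2; apply: (poly_boundedD IH1).
  by apply: (poly_boundedD IH2); apply: poly_bounded_const.
- by move=> t1 IH1; apply: (poly_boundedD IH1); apply: poly_bounded_const.
- move=> e1 e2 t1 IH1 t2 IH2.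
  apply: (@poly_boundedD (fun=> _)); first exact: poly_bounded_const.
  exact: poly_boundedD.
- move=> x N t1 IH1.
  apply: (@poly_boundedD (fun=> _)); first exact: poly_bounded_const.
  apply: poly_bounded_for; apply: (poly_boundedD IH1); exact: poly_bounded_const.
Qed.

Lemma poly_bounded_pcost p : poly_bounded (pcost p).
Proof.
elim: p => /=; try by move=> *; apply: poly_bounded_const.
- move=> a ix t.
  by apply: poly_boundedD (poly_bounded_tcost t) _; apply: poly_bounded_const.
- by move=> p1 IH1 p2 IH2; apply: poly_boundedD.
- move=> t p1 IH1; apply: poly_boundedD (poly_bounded_tcost t) _.
  by apply: (poly_boundedD IH1); apply: poly_bounded_const.
- by move=> x N p1 IH1; apply: poly_bounded_for.
Qed.

(** * Tables *)

Definition nest (bl : seq (nat * nat)) (p : prog) : prog :=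
  foldr (fun b q => PFor b.1 b.2 q) p bl.

Definition binders (bl : seq (nat * nat)) : seq nat := map fst bl.

Definition tab (a : nat) (bl : seq (nat * nat)) (t : fterm) : prog :=
  nest bl (PStore a (map IVar (binders bl)) t).

(* [t] may read [a]: the new values are first collected in array 13. *)
Definition tabc (a : nat) (bl : seq (nat * nat)) (t : fterm) : prog :=
  PSeq (tab 13 bl t) (tab a bl (TCell 13 (map IVar (binders bl)))).

Lemma modv_nest bl p : modv (nest bl p) = binders bl ++ modv p.
Proof. by elim: bl => //= b bl ->. Qed.

Lemma moda_nest bl p : moda (nest bl p) = moda p.
Proof. by elim: bl. Qed.

Lemma modv_tab a bl t : modv (tab a bl t) = binders bl.
Proof. by rewrite modv_nest /= cats0. Qed.

Lemma moda_tab a bl t : moda (tab a bl t) = [:: a].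
Proof. by rewrite moda_nest. Qed.

Definition good_binders (bl : seq (nat * nat)) : bool :=
  uniq (binders bl) && all (fun b => assignable b.1 && (b.2 < 7)%N) bl.

Section Tab.
Variable F : fieldType.
Implicit Type s : state F.

Fixpoint inbox s (bl : seq (nat * nat)) (ix : seq nat) : bool :=
  match bl, ix with
  | [::], [::] => true
  | b :: bl', i :: ix' => (i < ivar s b.2)%N && inbox s bl' ix'
  | _, _ => false
  end.

Fixpoint setvs s (bl : seq (nat * nat)) (ix : seq nat) : state F :=
  match bl, ix with
  | b :: bl', i :: ix' => setvs (setv s b.1 i) bl' ix'
  | _, _ => s
  end.

Lemma farr_setvs s bl ix : farr (setvs s bl ix) = farr s.
Proof. by elim: bl ix s => [|b bl IH] [|i ix] s //=; rewrite IH. Qed.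

Lemma inbox_ext s s' bl ix :
  (forall x, (x < 7)%N -> ivar s' x = ivar s x) ->
  all (fun b => (b.2 < 7)%N) bl -> inbox s' bl ix = inbox s bl ix.
Proof.
move=> E; elim: bl ix => [|b bl IH] [|i ix] //= /andP[hb hbl].
by rewrite E // IH.
Qed.

(** The states differ at most on the binders, and an address in the box has one index per binder, so
    every difference is overwritten. *)
Lemma setvs_ext s s' bl ix y : inbox s bl ix ->
  (forall x, x \notin binders bl -> ivar s' x = ivar s x) ->
  (forall x, (x < 7)%N -> ivar s' x = ivar s x) ->
  good_binders bl ->
  ivar (setvs s' bl ix) y = ivar (setvs s bl ix) y.
Proof.
elim: bl ix s s' => [|b bl IH] [|i ix] s s' //=; first by move=> _ E _ _; apply: E.
case/andP=> hi hin E E7 /andP[/= /andP[hb ub] /andP[/andP[hb1 hb2] ab]].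
have hb' : all (fun b => (b.2 < 7)%N) bl by apply: sub_all ab => c /andP[].
have lo x : (x < 7)%N -> x != b.1.
  by move=> hx; apply: contraTneq hx => ->; move: hb1; rewrite /assignable; lia.
apply: IH.
- rewrite (inbox_ext _ (s := s)) // => x hx.
  by rewrite setv_other // lo.
- move=> x hx; rewrite /= /upd_var; case: eqP => // /eqP hxb.
  by apply: E; rewrite inE negb_or hxb.
- by move=> x hx; rewrite !setv_other ?lo // E7.
- by rewrite /good_binders ub.
Qed.

Lemma for_run_ivar p x k s y : y \notin x :: modv p ->
  ivar (for_run (run p) x k s) y = ivar s y.
Proof.
rewrite inE negb_or => /andP[hy hp]; elim: k => // k IH.
by rewrite for_runS run_ivar // setv_other.
Qed.

Lemma for_run_farr p x k s a : a \notin moda p ->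
  farr (for_run (run p) x k s) a = farr s a.
Proof. by move=> hp; elim: k => // k IH; rewrite for_runS run_farr. Qed.

(** Induction on the inner loops needs the outer ones as a parameter: [ps] lists the counters
    already fixed, and only addresses that begin with their current values are written. As [t] does
    not read [a], earlier writes do not influence later ones. *)
Lemma run_nest (a : nat) (ps : seq nat) bl t s ix :
  good_binders bl -> {in ps, forall x, x \notin binders bl} ->
  tin xpredT (fun b => b != a) t ->
  farr (run (nest bl (PStore a (map IVar (ps ++ binders bl)) t)) s) a ix =
  if (take (size ps) ix == map (ivar s) ps) && inbox s bl (drop (size ps) ix)
  then teval (setvs s bl (drop (size ps) ix)) t else farr s a ix.
Proof.
elim: bl ps s ix => [|b bl IH] ps s ix.
  move=> _ _ _ /=; rewrite /upd_arr eqxx cats0 /ixeval -map_comp /=.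
  have -> : (take (size ps) ix == map (ivar s) ps) &&
     (if drop (size ps) ix is [::] then true else false) = (ix == map (ivar s) ps).
    rewrite -{3}(cat_take_drop (size ps) ix); case E: (drop (size ps) ix) => [|i l].
      by rewrite cats0 andbT.
    rewrite andbF; apply/esym/negP=> /eqP /(congr1 size).
    rewrite size_cat size_map /= size_take => h.
    by move/(congr1 size): E; rewrite size_drop /=; move: h; case: ltnP; lia.
  have -> : [seq (ieval s \o IVar) i | i <- ps] = map (ivar s) ps by apply: eq_map.
  by case: eqP.
move=> hg hps ht; have := hg => /andP[/= /andP[hb ub] /andP[/andP[hb1 hb2] ab]].
have hg' : good_binders bl by rewrite /good_binders ub.
have hb' : all (fun b => (b.2 < 7)%N) bl by apply: sub_all ab => c /andP[].
set f := run _.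
have low y : (y < 7)%N -> y \notin b.1 :: binders bl.
  move=> hy; apply/negP=> hin.
  have : all assignable (b.1 :: binders bl).
    by rewrite /= hb1 /= all_map; apply: sub_all ab => c /andP[].
  by move/allP/(_ _ hin); rewrite /assignable; lia.
have fv k y : y \notin b.1 :: binders bl -> ivar (for_run f b.1 k s) y = ivar s y.
  by move=> hy; apply: for_run_ivar; rewrite modv_nest /= cats0.
(* After [k] rounds of the outermost loop, the addresses written are those whose next index is below
   [k]. *)
suff H k : farr (for_run f b.1 k s) a ix =
    if (take (size ps) ix == map (ivar s) ps) &&
       (if drop (size ps) ix is i :: ix' then (i < k)%N && inbox s bl ix' else false)
    then teval (setvs s (b :: bl) (drop (size ps) ix)) t else farr s a ix by exact: H.
elim: k => [|k IHk]; first by case: (drop _ _) => [|i l]; rewrite /= ?andbF.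
rewrite for_runS /f -cat_rcons IH //; last first.
  move=> x; rewrite mem_rcons inE; case/predU1P=> [-> //|/hps].
  by rewrite inE negb_or => /andP[].
have Es : farr (setv (for_run f b.1 k s) b.1 k) a ix = farr (for_run f b.1 k s) a ix by [].
rewrite cat_rcons -/f size_rcons Es {}IHk {Es}.
have -> : [seq ivar (setv (for_run f b.1 k s) b.1 k) i | i <- rcons ps b.1] =
          rcons (map (ivar s) ps) k.
  rewrite map_rcons setv_same; congr rcons; apply/eq_in_map => y hy.
  have := hps _ hy => hyb; rewrite setv_other ?fv //.
  by move: hyb; rewrite inE negb_or => /andP[].
rewrite (inbox_ext (s := s)) //; last first.
  move=> y /low hy; rewrite setv_other ?fv //.
  by move: hy; rewrite inE negb_or => /andP[].
case E : (drop (size ps) ix) => [|i l].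
  have h : (size ix <= size ps)%N by move/(congr1 size): E; rewrite size_drop /=; lia.
  rewrite andbF; case: eqP => //= /(congr1 size).
  by rewrite size_rcons size_map take_oversize; lia.
have h : (size ps < size ix)%N by move/(congr1 size): E; rewrite size_drop /=; lia.
have Ei : nth 0%N ix (size ps) = i by rewrite -[size ps]addn0 -nth_drop E.
have -> : take (size ps).+1 ix = rcons (take (size ps) ix) i.
  by rewrite (take_nth 0%N) // Ei.
have -> : drop (size ps).+1 ix = l by rewrite -add1n -drop_drop E drop1.
rewrite eqseq_rcons; case: eqP => //= _; rewrite ltnS (leq_eqVlt i).
case: (eqVneq i k) => [->|] //=; rewrite ltnn /=; case: ifP => // hin.
apply: (teval_ext (V := xpredT) ht) => [y _|c jx hc]; last first.
  rewrite !farr_setvs /=; rewrite for_run_farr // moda_nest /= inE.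
  by [].
apply: setvs_ext => //.
- rewrite (inbox_ext (s := s)) // => y1 /low.
  by rewrite inE negb_or => /andP[hy _]; rewrite setv_other.
- move=> y1 hy; rewrite /= /upd_var; case: eqP => // /eqP hyb.
  by rewrite fv // inE negb_or hyb.
- move=> y1 /low hy; rewrite /= /upd_var; case: eqP => // _; exact: fv.
Qed.

Lemma run_tab (a : nat) bl t s ix :
  good_binders bl -> tin xpredT (fun b => b != a) t ->
  farr (run (tab a bl t) s) a ix =
  if inbox s bl ix then teval (setvs s bl ix) t else farr s a ix.
Proof. by move=> hg ht; rewrite /tab (@run_nest a [::]) // take0 drop0. Qed.

Lemma tab_ivar a bl t s x : x \notin binders bl -> ivar (run (tab a bl t) s) x = ivar s x.
Proof. by move=> hx; rewrite run_ivar // modv_tab. Qed.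

Lemma tab_farr (a : nat) bl t s (b : nat) : b != a -> farr (run (tab a bl t) s) b = farr s b.
Proof. by move=> hb; rewrite run_farr // moda_tab inE. Qed.

Lemma setvs_binders s bl ix : uniq (binders bl) -> size ix = size bl ->
  map (ivar (setvs s bl ix)) (binders bl) = ix.
Proof.
have keep s' bl' ix' x : x \notin binders bl' -> ivar (setvs s' bl' ix') x = ivar s' x.
  elim: bl' ix' s' => [|b bl' IH] [|i ix'] s' //=; rewrite inE negb_or => /andP[hx h].
  by rewrite IH // setv_other.
elim: bl ix s => [|b bl IH] [|i ix] s //= /andP[hb ub] [hs].
by rewrite IH // keep // setv_same.
Qed.

Lemma inbox_size s bl ix : inbox s bl ix -> size ix = size bl.
Proof. by elim: bl ix => [|b bl IH] [|i ix] //= /andP[_ /IH ->]. Qed.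

Lemma run_tabc (a : nat) bl t s ix :
  a != 13%N -> good_binders bl -> tin xpredT (fun b => b != 13%N) t ->
  farr (run (tabc a bl t) s) a ix =
  if inbox s bl ix then teval (setvs s bl ix) t else farr s a ix.
Proof.
move=> ha hg ht; rewrite /tabc /= run_tab //=; last first.
  by rewrite eq_sym ha all_map; apply/allP.
have hg' := hg; move/andP: hg => [ub ab].
rewrite (inbox_ext (s := s)); first last.
- by apply: sub_all ab => c /andP[].
- move=> x hx; rewrite tab_ivar //; apply/negP=> hin.
  have : all assignable (binders bl) by rewrite all_map; apply: sub_all ab => c /andP[].
  by move/allP/(_ _ hin); rewrite /assignable; lia.
case: ifP => hin; last by rewrite tab_farr.
rewrite farr_setvs /ixeval -map_comp.
have -> : [seq (ieval (setvs (run (tab 13 bl t) s) bl ix) \o IVar) i | i <- binders bl] = ix.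
  exact: setvs_binders ub (inbox_size hin).
by rewrite run_tab // hin.
Qed.

End Tab.

(** * Spanning sets by rank-one updates *)

Section Pivot.
Variables (F : fieldType) (I : finType).
Variables (P R B : I -> I -> F) (v : I -> F) (p : I).

Let u y := \sum_x v x * P x y.
Let z y := \sum_x v x * R x y.
Let col x := P x p * (u p)^-1.

(** In matrix form [P] loses [col u] and [R] loses [col z], where [u = v P], [z = v R] and [col] is
    scaled so that [v col = 1]. Hence [v] gets killed; and if [w P = 0] then [w col = 0], so
    whatever was killed before stays killed. *)
Definition pivotP x y := P x y - col x * u y.
Definition pivotR x y := if y == p then col x else R x y - col x * z y.
Definition pivotB x y := if x == p then v y else B x y.

Hypothesis up : u p != 0.
Hypothesis PRB : forall x y, P x y + \sum_q R x q * B q y = (x == y)%:R.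
(** A filled slot has a zero column in [P], a free one a zero column in [R]. So [(v P)_p <> 0]
    forces [p] to be free, and overwriting row [p] of [B] does not change [R B]. *)
Hypothesis slot : forall q, (forall x, P x q = 0) \/ (forall x, R x q = 0).

Lemma pivot_slot q : (forall x, pivotP x q = 0) \/ (forall x, pivotR x q = 0).
Proof.
have [->|nqp] := eqVneq q p.
  by left=> x; rewrite /pivotP /col -mulrA mulVf // mulr1 subrr.
have [h|h] := slot q; [left|right] => x.
  by rewrite /pivotP h /u big1 ?mulr0 ?subr0 // => y _; rewrite h mulr0.
by rewrite /pivotR (negbTE nqp) h /z big1 ?mulr0 ?subr0 // => y _; rewrite h mulr0.
Qed.

(** The new sum is [P + R B + col (v - u - z B)], and the bracket vanishes because
    [v = v (P + R B) = u + z B]. *)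
Lemma pivot_decomp x y : pivotP x y + \sum_q pivotR x q * pivotB q y = (x == y)%:R.
Proof.
have Rp t : R t p = 0.
  case: (slot p) => // h; move: up; rewrite /u big1 ?eqxx // => t' _.
  by rewrite h mulr0.
have zB : \sum_q z q * B q y = v y - u y.
  rewrite /z; under eq_bigr do rewrite mulr_suml.
  rewrite exchange_big /=.
  under eq_bigr => t _.
    under eq_bigr do rewrite -mulrA.
    rewrite -mulr_sumr (_ : \sum_q R t q * B q y = (t == y)%:R - P t y); last first.
      by rewrite -PRB addrAC subrr add0r.
    rewrite mulrBr.
    over.
  rewrite sumrB (bigD1 y) //= eqxx mulr1 big1 ?addr0 // => t /negbTE ->.
  by rewrite mulr0.
have zp : z p = 0 by rewrite /z big1 // => t _; rewrite Rp mulr0.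
rewrite (bigD1 p) //= {1}/pivotR {1}/pivotB !eqxx.
rewrite (eq_bigr (fun q => R x q * B q y - col x * (z q * B q y))); last first.
  by move=> q /negbTE h; rewrite /pivotR /pivotB h mulrBl mulrA.
rewrite sumrB -mulr_sumr.
have -> : \sum_(q | q != p) R x q * B q y = (x == y)%:R - P x y.
  by rewrite -PRB [X in _ + X - _](bigD1 p) //= Rp mul0r add0r addrAC subrr add0r.
have -> : \sum_(q | q != p) z q * B q y = v y - u y.
  by rewrite -zB [RHS](bigD1 p) //= zp mul0r add0r.
rewrite /pivotP; ring.
Qed.

Lemma pivot_mono w : (forall y, \sum_x w x * P x y = 0) ->
  forall y, \sum_x w x * pivotP x y = 0.
Proof.
move=> h y; rewrite /pivotP; under eq_bigr do rewrite mulrBr.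
rewrite sumrB h sub0r; apply/eqP; rewrite oppr_eq0; apply/eqP.
under eq_bigr do rewrite /col !mulrA.
by rewrite -!mulr_suml h !mul0r.
Qed.

Lemma pivot_kill y : \sum_x v x * pivotP x y = 0.
Proof.
rewrite /pivotP; under eq_bigr do rewrite mulrBr.
rewrite sumrB; under [X in _ - X]eq_bigr do rewrite /col !mulrA.
by rewrite -!mulr_suml -/(u y) -/(u p) mulfV // mul1r subrr.
Qed.

End Pivot.

(** * The program that passes from one level to the next *)

Notation cell a xs := (TCell a (map IVar xs)).
Notation "t1 '*t' t2" := (TOp OMul t1 t2) (at level 40, left associativity).
Notation "t1 '-t' t2" := (TOp OSub t1 t2) (at level 50, left associativity).

Local Open Scope nat_scope.

Definition pairs (L W : nat) : seq (nat * nat) := [:: (20, L); (21, W)].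
Definition pairs2 (L W : nat) : seq (nat * nat) :=
  [:: (20, L); (21, W); (22, L); (23, W)].
Definition slotvars (L W : nat) : seq (nat * nat) :=
  [:: (20, L); (21, W); (22, 0); (23, 4); (24, 4)].

(* Slots and coordinates are pairs (block, state), with bounds in variables [L]
   and [W].  Arrays 2 and 4 hold the vectors and the substitutions of the old
   slots, arrays 8 and 5 those of the new ones, array 3 the layer by degree;
   arrays 6 and 7 are the matrices [P] and [R], array 9 is the vector [v] being
   inserted, and arrays 10 and 12 are [v P] and [v R].  Variable 12 is the ROABP
   variable that the layer reads. *)
Definition level_vec (L W : nat) : prog :=
  tab 9 (pairs L W)
    (TSum 100 W (cell 2 [:: 15; 16; 20; 100] *t cell 3 [:: 14; 20; 100; 21])).

Definition level_row (L W : nat) : prog :=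
  tab 10 (pairs L W)
    (TSum 100 L (TSum 101 W (cell 9 [:: 100; 101] *t cell 6 [:: 100; 101; 20; 21]))).

(** The column [col] and the row [v R] are frozen in arrays 11 and 12 before [P] and [R] change. The
    filled slot also receives a table: that of the slot extended, with variable 12 fixed at the
    exponent in variable 14. *)
Definition level_update (L W : nat) : prog :=
  let Rnew := cell 7 [:: 20; 21; 22; 23] -t cell 11 [:: 20; 21] *t cell 12 [:: 22; 23] in
  PSeq (tab 11 (pairs L W) (cell 6 [:: 20; 21; 17; 18] *t TInv (cell 10 [:: 17; 18])))
  (PSeq (tab 12 (pairs L W)
    (TSum 100 L (TSum 101 W (cell 9 [:: 100; 101] *t cell 7 [:: 100; 101; 20; 21]))))
  (PSeq (tabc 7 (pairs2 L W)
    (TIf (IVar 22) (IVar 17) (TIf (IVar 23) (IVar 18) (cell 11 [:: 20; 21]) Rnew) Rnew))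
  (PSeq (tabc 6 (pairs2 L W)
    (cell 6 [:: 20; 21; 22; 23] -t cell 11 [:: 20; 21] *t cell 10 [:: 22; 23]))
  (PSeq (tabc 8 (pairs2 L W)
    (TIf (IVar 20) (IVar 17)
      (TIf (IVar 21) (IVar 18) (cell 9 [:: 22; 23]) (cell 8 [:: 20; 21; 22; 23]))
      (cell 8 [:: 20; 21; 22; 23])))
  (tabc 5 (slotvars L W)
    (TIf (IVar 20) (IVar 17)
      (TIf (IVar 21) (IVar 18)
        (TIf (IVar 22) (IVar 12) (cell 4 [:: 15; 16; 22; 14; 24])
           (cell 4 [:: 15; 16; 22; 23; 24]))
        (cell 5 [:: 20; 21; 22; 23; 24]))
      (cell 5 [:: 20; 21; 22; 23; 24]))))))).

Definition level_pivot (L W : nat) : prog :=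
  PSeq (level_row L W) (PIf (cell 10 [:: 17; 18]) (level_update L W)).

(** No pivot is searched for. Every position is tried and [v P] is recomputed each time; after an
    insertion [v P = 0], so the remaining positions change nothing. *)
Definition level_vector (L W : nat) : prog :=
  PSeq (level_vec L W) (PFor 17 L (PFor 18 W (level_pivot L W))).

Definition level_init (L W : nat) : prog :=
  PSeq (tab 6 (pairs2 L W)
    (TIf (IVar 20) (IVar 22) (TIf (IVar 21) (IVar 23) TOne TZero) TZero))
  (PSeq (tab 7 (pairs2 L W) TZero)
  (PSeq (tab 8 (pairs2 L W) TZero)
  (tab 5 (slotvars L W) TZero))).

Definition level (L W : nat) : prog :=
  PSeq (level_init L W) (PFor 14 4 (PFor 15 L (PFor 16 W (level_vector L W)))).

Local Open Scope ring_scope.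

#[local] Arguments tab : simpl never.
#[local] Arguments tabc : simpl never.

(** * Correctness of one level *)

Section Rules.
Variable F : fieldType.
Implicit Type s : state F.

Lemma forP (Inv : nat -> state F -> Prop) x N p s :
  Inv 0%N s ->
  (forall i s1, (i < ivar s N)%N -> Inv i s1 -> Inv i.+1 (run p (setv s1 x i))) ->
  (forall s1 v, Inv (ivar s N) s1 -> Inv (ivar s N) (setv s1 x v)) ->
  Inv (ivar s N) (run (PFor x N p) s).
Proof.
move=> H0 Hs He; rewrite /=; apply: He.
suff H k : (k <= ivar s N)%N -> Inv k (for_run (run p) x k s) by apply: H.
elim: k => // k IH hk; rewrite for_runS; apply: Hs => //.
exact: IH (ltnW hk).
Qed.

Lemma run_PSeq p1 p2 s : run (PSeq p1 p2) s = run p2 (run p1 s).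
Proof. by []. Qed.

Lemma run_PIf t p s : run (PIf t p) s = if teval s t == 0 then s else run p s.
Proof. by []. Qed.

Lemma upd_low (m : nat -> nat) x v y : (y < 7)%N -> (7 <= x)%N -> upd_var m x v y = m y.
Proof. by move=> hy hx; rewrite /upd_var; case: eqP => // E; lia. Qed.

Lemma teval_sum2 s L W t n1 n2 : (W < 7)%N ->
  ivar s L = n1 -> ivar s W = n2 ->
  teval s (TSum 100 L (TSum 101 W t)) =
  \sum_(x : 'I_n1 * 'I_n2) teval (setv (setv s 100 x.1) 101 x.2) t.
Proof.
move=> hW <- <-; rewrite [LHS]/= -(pair_bigA _ (fun (i : 'I_(ivar s L)) (j : 'I_(ivar s W)) =>
  teval (setv (setv s 100 i) 101 j) t)) /=.
by apply: eq_bigr => i _; rewrite upd_low.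
Qed.

Lemma teval_sum1 s W t n : ivar s W = n ->
  teval s (TSum 100 W t) = \sum_(q < n) teval (setv s 100 q) t.
Proof. by move=> <-. Qed.

Lemma pairE n1 n2 (x y : 'I_n1 * 'I_n2) :
  (x == y) = (x.1 == y.1 :> nat) && (x.2 == y.2 :> nat).
Proof. by case: x y => [x1 x2] [y1 y2]. Qed.

Lemma tab_low a bl t s z : all (leq 20) (binders bl) -> (z < 20)%N ->
  ivar (run (tab a bl t) s) z = ivar s z.
Proof.
by move=> /allP h hz; rewrite tab_ivar //; apply/negP=> /h; rewrite leqNgt hz.
Qed.

Lemma tabc_low a bl t s z : all (leq 20) (binders bl) -> (z < 20)%N ->
  ivar (run (tabc a bl t) s) z = ivar s z.
Proof. by move=> h hz; rewrite /tabc run_PSeq !tab_low. Qed.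

Lemma tab_pairs (a L W : nat) t s n1 n2 (z : 'I_n1 * 'I_n2) :
  (L < 7)%N -> (W < 7)%N -> ivar s L = n1 -> ivar s W = n2 ->
  tin xpredT (fun b => b != a) t ->
  farr (run (tab a (pairs L W) t) s) a [:: val z.1; val z.2] =
  teval (setv (setv s 20 z.1) 21 z.2) t.
Proof.
move=> hL hW e1 e2 ht; rewrite run_tab //; last by rewrite /good_binders /= hL hW.
by rewrite /inbox /pairs e1 e2 !ltn_ord.
Qed.

Lemma tabc_farr (a : nat) bl t s (b : nat) : b != 13%N -> b != a ->
  farr (run (tabc a bl t) s) b = farr s b.
Proof. by move=> h hz; rewrite /tabc run_PSeq !tab_farr. Qed.

End Rules.

Section Level.
Variables (F : fieldType) (L W : nat) (s0 : state F).
Hypotheses (hL : (L < 7)%N) (hW : (W < 7)%N).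

Let n1 := ivar s0 L.
Let n2 := ivar s0 W.
Let n := ivar s0 0.
Let D := ivar s0 4.
Local Notation I := ('I_n1 * 'I_n2)%type.
Implicit Types (s : state F) (x y p q : I).

Definition rd2 n1' n2' s a (x : 'I_n1' * 'I_n2') : F := farr s a [:: val x.1; val x.2].
Definition rd4 n1' n2' s a (x y : 'I_n1' * 'I_n2') : F :=
  farr s a [:: val x.1; val x.2; val y.1; val y.2].

Definition stepvec (e : nat) x y : F :=
  \sum_(q < n2) farr s0 2 [:: val x.1; val x.2; val y.1; val q] *
                farr s0 3 [:: e; val y.1; val q; val y.2].

Definition fixed (e : nat) x v e1 e2 : F :=
  if v == ivar s0 12 then farr s0 4 [:: val x.1; val x.2; v; e; e2]
  else farr s0 4 [:: val x.1; val x.2; v; e1; e2].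

Definition keep s : Prop :=
  [/\ forall z : nat, (z < 7)%N -> ivar s z = ivar s0 z, ivar s 12 = ivar s0 12 &
      forall a, a \in [:: 2; 3; 4]%N -> farr s a = farr s0 a].

Definition slotG (a : nat) s p (g : nat -> nat -> nat -> F) : Prop :=
  forall v e1 e2, (v < n)%N -> (e1 < D)%N -> (e2 < D)%N ->
    farr s a [:: val p.1; val p.2; v; e1; e2] = g v e1 e2.

(** Vector and table of a filled slot stem from the same extension [(e, x)]. This link allows a
    relation between vectors to be read as one between restricted polynomials. *)
Definition slot_ok s p : Prop :=
  ((forall y, rd4 s 8 p y = 0) /\ slotG 5 s p (fun _ _ _ => 0)) \/
  exists e x, [/\ (e < D)%N, forall y, rd4 s 8 p y = stepvec e x y & slotG 5 s p (fixed e x)].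

Definition core s : Prop :=
  [/\ keep s,
      forall x y, rd4 s 6 x y + \sum_q rd4 s 7 x q * rd4 s 8 q y = (x == y)%:R,
      forall q, (forall x, rd4 s 6 x q = 0) \/ (forall x, rd4 s 7 x q = 0) &
      forall p, slot_ok s p].

Lemma core_low s z : core s -> (z < 7)%N -> ivar s z = ivar s0 z.
Proof. by case=> -[k _ _] _ _ _; apply: k. Qed.

Definition kills s (w : I -> F) : Prop := forall y, \sum_x w x * rd4 s 6 x y = 0.

Lemma keep_run prg s : pwf prg -> 12 \notin modv prg ->
  all (fun a => a \notin moda prg) [:: 2; 3; 4]%N -> keep s -> keep (run prg s).
Proof.
move=> hp h12 /allP ha [k1 k2 k3]; split.
- by move=> z hz; rewrite run_bound // k1.
- by rewrite run_ivar.
- by move=> a h; rewrite run_farr ?k3 //; apply: ha.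
Qed.

Lemma pwf_update : pwf (level_update L W).
Proof.
by rewrite /= /twf /= /uservar /= !hL !hW !(ltn_trans hL, ltn_trans hW) ?orbT.
Qed.

Lemma updateE s x y p e (sl : I) (s' := run (level_update L W) s) :
  keep s -> ivar s 17 = val p.1 -> ivar s 18 = val p.2 ->
  ivar s 14 = e -> ivar s 15 = val sl.1 -> ivar s 16 = val sl.2 ->
  (forall y, rd2 s 10 y = \sum_x rd2 s 9 x * rd4 s 6 x y) ->
  [/\ rd4 s' 6 x y = pivotP (@rd4 n1 n2 s 6) (rd2 s 9) p x y,
      rd4 s' 7 x y = pivotR (@rd4 n1 n2 s 6) (rd4 s 7) (rd2 s 9) p x y,
      rd4 s' 8 x y = pivotB (@rd4 n1 n2 s 8) (rd2 s 9) p x y &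
      forall v e1 e2, (v < n)%N -> (e1 < D)%N -> (e2 < D)%N ->
      farr s' 5 [:: val x.1; val x.2; v; e1; e2] =
        if x == p then fixed e sl v e1 e2 else farr s 5 [:: val x.1; val x.2; v; e1; e2]].
Proof.
move=> [k1 k2 k3] h17 h18 h14 h15 h16 h10.
have eL : ivar s L = n1 by rewrite k1.
have eW : ivar s W = n2 by rewrite k1.
have gb : good_binders (pairs L W) by rewrite /good_binders /= hL hW.
have gb4 : good_binders (pairs2 L W) by rewrite /good_binders /= hL hW.
have gb5 : good_binders (slotvars L W) by rewrite /good_binders /= hL hW.
rewrite /s' /level_update; set Rn := cell 7 _ -t _.
rewrite run_PSeq; move E1 : (run (tab 11 _ _) s) => s1.
rewrite run_PSeq; move E2 : (run (tab 12 _ _) s1) => s2.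
rewrite run_PSeq; move E3 : (run (tabc 7 _ _) s2) => s3.
rewrite run_PSeq; move E4 : (run (tabc 6 _ _) s3) => s4.
rewrite run_PSeq; move E5 : (run (tabc 8 _ _) s4) => s5.
move E6 : (run (tabc 5 _ _) s5) => s6.
have L20 : (L < 20)%N by rewrite (ltn_trans hL).
have W20 : (W < 20)%N by rewrite (ltn_trans hW).
have i1 z : (z < 20)%N -> ivar s1 z = ivar s z by move=> hz; rewrite -E1 tab_low.
have i2 z : (z < 20)%N -> ivar s2 z = ivar s z by move=> hz; rewrite -E2 tab_low ?i1.
have i3 z : (z < 20)%N -> ivar s3 z = ivar s z by move=> hz; rewrite -E3 tabc_low ?i2.
have i4 z : (z < 20)%N -> ivar s4 z = ivar s z by move=> hz; rewrite -E4 tabc_low ?i3.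
have i5 z : (z < 20)%N -> ivar s5 z = ivar s z by move=> hz; rewrite -E5 tabc_low ?i4.
have g1 (z : nat) : z != 11%N -> farr s1 z = farr s z by move=> h; rewrite -E1 tab_farr.
have g2 (z : nat) : z != 12%N -> farr s2 z = farr s1 z by move=> h; rewrite -E2 tab_farr.
have g3 (z : nat) : z != 13%N -> z != 7%N -> farr s3 z = farr s2 z.
  by move=> h h'; rewrite -E3 tabc_farr.
have g4 (z : nat) : z != 13%N -> z != 6%N -> farr s4 z = farr s3 z.
  by move=> h h'; rewrite -E4 tabc_farr.
have g5 (z : nat) : z != 13%N -> z != 8%N -> farr s5 z = farr s4 z.
  by move=> h h'; rewrite -E5 tabc_farr.
have g6 (z : nat) : z != 13%N -> z != 5%N -> farr s6 z = farr s5 z.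
  by move=> h h'; rewrite -E6 tabc_farr.
have f11 (z : I) : farr s1 11 [:: val z.1; val z.2] = rd4 s 6 z p * (rd2 s 10 p)^-1.
  by rewrite -E1 run_tab //= eL eW !ltn_ord /= /upd_var /= h17 h18.
have f12 (z : I) : farr s2 12 [:: val z.1; val z.2] = \sum_x rd2 s 9 x * rd4 s 7 x z.
  rewrite -E2 (@tab_pairs _ _ _ _ _ _ n1 n2) ?i1 //; last by rewrite /= ?orbT.
  rewrite (@teval_sum2 _ _ _ _ _ n1 n2) //; try by rewrite /= !upd_low ?i1.
  by apply: eq_bigr => y0 _; rewrite /= /upd_var /= !g1.
have f3 (z1 z2 : I) : rd4 s3 7 z1 z2 = pivotR (@rd4 n1 n2 s 6) (rd4 s 7) (rd2 s 9) p z1 z2.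
  rewrite /rd4 -E3 run_tabc //= !i2 // eL eW !ltn_ord /= /upd_var /= !i2 // h17 h18.
  rewrite !(g2 11) // !(g2 7) // !(g1 7) //.
  rewrite f12 f11 h10 /pivotR pairE; by do 2 case: eqP.
have f4 (z1 z2 : I) : rd4 s4 6 z1 z2 = pivotP (@rd4 n1 n2 s 6) (rd2 s 9) p z1 z2.
  rewrite /rd4 -E4 run_tabc //= !i3 // eL eW !ltn_ord /= /upd_var /=.
  rewrite !g3 // !g2 // f11 !g1 // /pivotP -!h10.
  by [].
have f5 (z1 z2 : I) : rd4 s5 8 z1 z2 = pivotB (@rd4 n1 n2 s 8) (rd2 s 9) p z1 z2.
  rewrite /rd4 -E5 run_tabc //= !i4 // eL eW !ltn_ord /= /upd_var /= !i4 // h17 h18.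
  rewrite !g4 // !g3 // !g2 // !g1 // /pivotB pairE; by do 2 case: eqP.
split.
- by rewrite -f4 /rd4 g6 // g5.
- by rewrite -f3 /rd4 g6 // g5 // g4.
- by rewrite -f5 /rd4 g6.
move=> v e1 e2 hv he1 he2.
rewrite -E6 run_tabc //= !i5 // eL eW !k1 // !ltn_ord hv he1 he2 /= /upd_var /=.
rewrite !i5 // h14 h15 h16 h17 h18 k2 !g5 // !g4 // !g3 // !g2 // !g1 // !(k3 4) //.
by rewrite /fixed pairE; do 3 case: eqP.
Qed.

Lemma core_ext s s' : core s -> keep s' ->
  (forall a, a \in [:: 5; 6; 7; 8]%N -> farr s' a = farr s a) -> core s'.
Proof.
case=> _ c1 c2 c3 k E; split=> //.
- by move=> x y; rewrite -c1 /rd4 !E.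
- by move=> q; case: (c2 q) => h; [left|right] => x; rewrite -[RHS](h x) /rd4 E.
- move=> p; case: (c3 p) => [[h1 h2]|[e [x [he h1 h2]]]]; [left|right].
    by split; [move=> y; rewrite -[RHS](h1 y) /rd4 E|move=> *; rewrite E ?h2].
  by exists e, x; split; [|move=> y; rewrite -h1 /rd4 E|move=> *; rewrite E ?h2].
Qed.

Lemma pwf_pairs a t : userarr a -> twf t -> pwf (tab a (pairs L W) t).
Proof. by move=> ha ht; rewrite /= /userarr in ha *; rewrite ha ht hL hW. Qed.

Lemma twf_row a : userarr a ->
  twf (TSum 100 L (TSum 101 W (cell 9 [:: 100; 101]%N *t cell a [:: 100; 101; 20; 21]%N))).
Proof. by move=> ha; rewrite /twf /= /uservar /= hL hW ha !(ltn_trans hL, ltn_trans hW) ?orbT. Qed.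

Lemma pivot_ok s p e (sl : I) (s' := run (level_pivot L W) s) :
  core s -> ivar s 17 = val p.1 -> ivar s 18 = val p.2 ->
  ivar s 14 = e -> ivar s 15 = val sl.1 -> ivar s 16 = val sl.2 -> (e < D)%N ->
  (forall y, rd2 s 9 y = stepvec e sl y) ->
  [/\ core s', forall w, kills s w -> kills s' w,
      forall y, rd2 s' 9 y = stepvec e sl y &
      kills s' (stepvec e sl) \/ ((forall x y, rd4 s' 6 x y = rd4 s 6 x y) /\
        \sum_x stepvec e sl x * rd4 s 6 x p = 0)].
Proof.
move=> cs h17 h18 h14 h15 h16 he h9; have [k c1 c2 c3] := cs.
have [k1 k2 k3] := k.
rewrite /s' /level_pivot run_PSeq; move E1 : (run (level_row L W) s) => s1.
have g1 (a : nat) : a != 10%N -> farr s1 a = farr s a.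
  by move=> h; rewrite -E1 tab_farr.
have i1 z : (z < 20)%N -> ivar s1 z = ivar s z.
  by move=> h; rewrite -E1 tab_low.
have k' : keep s1.
  rewrite -E1; apply: keep_run => //; exact: pwf_pairs (twf_row _).
have cs1 : core s1.
  by apply: core_ext cs k' _ => a; rewrite !inE => /or4P[] /eqP ->; rewrite g1.
have f10 (y : I) : rd2 s1 10 y = \sum_x stepvec e sl x * rd4 s 6 x y.
  rewrite /rd2 -E1 (@tab_pairs _ _ _ _ _ _ n1 n2) ?k1 //; last by rewrite /= ?orbT.
  rewrite (@teval_sum2 _ _ _ _ _ n1 n2) //; try by rewrite /= !upd_low ?k1.
  by apply: eq_bigr => x _; rewrite -h9 /= /upd_var.
have -> : run (PIf (cell 10 [:: 17; 18]%N) (level_update L W)) s1 =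
    if rd2 s1 10 p == 0 then s1 else run (level_update L W) s1.
  by rewrite run_PIf [teval _ _]/= !i1 // h17 h18.
case: eqP => [u0|/eqP u0].
  split=> //.
  - by move=> w hw y; rewrite -[RHS](hw y); apply: eq_bigr => x _; rewrite /rd4 g1.
  - by move=> y; rewrite -h9 /rd2 g1.
  - by right; split; [move=> x y; rewrite /rd4 g1|rewrite -f10].
move E2 : (run (level_update L W) s1) => s2.
have h9' (y : I) : rd2 s1 9 y = stepvec e sl y by rewrite -h9 /rd2 g1.
have f10' (y : I) : rd2 s1 10 y = \sum_x rd2 s1 9 x * rd4 s1 6 x y.
  by rewrite f10; apply: eq_bigr => x _; rewrite h9' /rd4 g1.
have U x y := @updateE s1 x y p e sl k' (etrans (i1 17 erefl) h17) (etrans (i1 18 erefl) h18)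
  (etrans (i1 14 erefl) h14) (etrans (i1 15 erefl) h15) (etrans (i1 16 erefl) h16) f10'.
rewrite E2 in U.
have [_ c1' c2' c3'] := cs1.
have u0' : \sum_x rd2 s1 9 x * rd4 s1 6 x p != 0 by rewrite -f10'.
have k2' : keep s2.
  by rewrite -E2; apply: keep_run; rewrite ?pwf_update.
split.
- split=> //.
  + move=> x y; have [-> _ _ _] := U x y.
    rewrite -(pivot_decomp u0' c1' c2' x y); congr (_ + _).
    apply: eq_bigr => q _; have [_ -> _ _] := U x q; by have [_ _ -> _] := U q y.
  + move=> q; case: (pivot_slot u0' c2' q) => h; [left|right] => x.
      by have [-> _ _ _] := U x q.
    by have [_ -> _ _] := U x q.
  + move=> q; have [nqp|nqp] := eqVneq q p.
      right; exists e, sl; split=> //.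
        by move=> y; have [_ _ -> _] := U q y; rewrite /pivotB nqp eqxx h9'.
      by move=> v e1 e2 hv h1 h2; have [_ _ _ ->] := U q q; rewrite // nqp eqxx.
    case: (c3' q) => [[h1 h2]|[e' [x' [he' h1 h2]]]]; [left|right].
      split; first by move=> y; have [_ _ -> _] := U q y; rewrite /pivotB (negbTE nqp).
      by move=> v e1 e2 *; have [_ _ _ ->] := U q q; rewrite // (negbTE nqp) h2.
    exists e', x'; split=> //.
      by move=> y; have [_ _ -> _] := U q y; rewrite /pivotB (negbTE nqp).
    by move=> v e1 e2 *; have [_ _ _ ->] := U q q; rewrite // (negbTE nqp) h2.
- move=> w hw y; under eq_bigr => x _ do [have [-> _ _ _] := U x y].
  apply: pivot_mono => z; rewrite -[RHS](hw z); apply: eq_bigr => x _.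
  by rewrite /rd4 g1.
- move=> y; rewrite -h9' /rd2 -E2 run_farr //.
left=> y; under eq_bigr => x _ do [have [-> _ _ _] := U x y; rewrite -h9'].
exact: pivot_kill u0' y.
Qed.

(** [S] is the set of positions already tried: either an insertion has killed the vector, or all
    entries of [v P] met so far were zero. Once [S] contains every position, both cases say
    [v P = 0]. *)
Definition vinv s e (sl : I) (S : I -> bool) s2 : Prop :=
  [/\ core s2, [/\ ivar s2 14 = e, ivar s2 15 = val sl.1 & ivar s2 16 = val sl.2],
      forall y, rd2 s2 9 y = stepvec e sl y, forall w, kills s w -> kills s2 w &
      kills s2 (stepvec e sl) \/
        forall p, S p -> \sum_x stepvec e sl x * rd4 s2 6 x p = 0].

Lemma core_setv s (x v : nat) : (7 <= x)%N -> x != 12%N -> core s -> core (setv s x v).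
Proof.
move=> hx hx' cs; apply: (core_ext cs) => //.
have [[k1 k2 k3] _ _ _] := cs; split=> //.
  by move=> z hz; rewrite /= upd_low // k1.
by rewrite setv_other // eq_sym.
Qed.

Lemma vinv_setv s e sl S s2 (x v : nat) : x \in [:: 17; 18]%N ->
  vinv s e sl S s2 -> vinv s e sl S (setv s2 x v).
Proof.
by rewrite !inE => /orP[] /eqP -> [c [h1 h2 h3] h4 h5 h6]; split=> //; apply: core_setv.
Qed.

Lemma vinvW s e sl (S S' : I -> bool) s2 : (forall p, S' p -> S p) ->
  vinv s e sl S s2 -> vinv s e sl S' s2.
Proof.
move=> SS [c h1 h2 h3 h4]; split=> //; case: h4 => h; [by left|right=> p /SS].
exact: h.
Qed.

Lemma vinv_step s e sl S s2 p : (e < D)%N -> vinv s e sl S s2 ->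
  ivar s2 17 = val p.1 -> ivar s2 18 = val p.2 ->
  vinv s e sl (fun q => S q || (q == p)) (run (level_pivot L W) s2).
Proof.
move=> he [c [h14 h15 h16] h9 hm hk] h17 h18.
have [c' m' h9' k'] := pivot_ok c h17 h18 h14 h15 h16 he h9.
split=> //.
- by rewrite !run_ivar.
- by move=> w /hm /m'.
case: k' => [|[E u0]]; first by left.
case: hk => hk; first by left; apply: m'.
right=> q /orP[/hk h|/eqP ->]; first by rewrite -[RHS]h; apply: eq_bigr => x _; rewrite E.
by rewrite -[RHS]u0; apply: eq_bigr => x _; rewrite E.
Qed.

Lemma vector_ok s e (sl : I) (s' := run (level_vector L W) s) :
  core s -> ivar s 14 = e -> ivar s 15 = val sl.1 -> ivar s 16 = val sl.2 -> (e < D)%N ->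
  [/\ core s', forall w, kills s w -> kills s' w & kills s' (stepvec e sl)].
Proof.
move=> cs h14 h15 h16 he; have [k c1 c2 c3] := cs.
have [k1 k2 k3] := k.
rewrite /s' /level_vector run_PSeq; move E1 : (run (level_vec L W) s) => s1.
have g1 (a : nat) : a != 9%N -> farr s1 a = farr s a.
  by move=> h; rewrite -E1 tab_farr.
have i1 z : (z < 20)%N -> ivar s1 z = ivar s z.
  by move=> h; rewrite -E1 tab_low.
have cs1 : core s1.
  apply: core_ext cs _ _ => [|a].
    rewrite -E1; apply: keep_run k => //; apply: pwf_pairs => //.
    by rewrite /twf /= /uservar /= hW ?(ltn_trans hW) ?orbT.
  by rewrite !inE => /or4P[] /eqP ->; rewrite g1.
have f9 (y : I) : rd2 s1 9 y = stepvec e sl y.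
  rewrite /rd2 -E1 (@tab_pairs _ _ _ _ _ _ n1 n2) ?k1 //.
  rewrite (@teval_sum1 _ _ _ _ n2) //; last by rewrite /= !upd_low ?k1.
  by apply: eq_bigr => q _; rewrite /= /upd_var /= h14 h15 h16 !k3.
have V1 : vinv s e sl (fun p => p.1 < 0)%N s1.
  split=> //; [by rewrite !i1| |by right].
  by move=> w hw y; rewrite -[RHS](hw y); apply: eq_bigr => x _; rewrite /rd4 g1.
have eL : ivar s1 L = n1 by apply: core_low.
suff : vinv s e sl (fun p => p.1 < ivar s1 L)%N
    (run (PFor 17 L (PFor 18 W (level_pivot L W))) s1).
  rewrite eL => -[c _ h9 hm hk]; split=> //.
  by case: hk => // hk p; apply: hk.
apply: (forP (Inv := fun i s2 => vinv s e sl (fun p => p.1 < i)%N s2)) => //; last first.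
  by move=> s2 v; apply: vinv_setv.
move=> i s2 hi; rewrite eL in hi => V2.
have {V2} : (ivar (setv s2 17 i) 17 = i) /\ vinv s e sl
    (fun p => (p.1 < i) || (p.1 == i :> nat) && (p.2 < 0))%N (setv s2 17 i).
  split; first exact: setv_same.
  by apply: vinv_setv => //; apply: vinvW V2 => p; rewrite andbF orbF.
move: (setv s2 17 i) => s3 V3.
have eW : ivar s3 W = n2 by have [_ [c4 _ _ _ _]] := V3; apply: core_low.
suff : ivar (run (PFor 18 W (level_pivot L W)) s3) 17 = i /\ vinv s e sl
    (fun p => (p.1 < i) || (p.1 == i :> nat) && (p.2 < ivar s3 W))%N
    (run (PFor 18 W (level_pivot L W)) s3).
  rewrite eW => -[_ V4]; apply: vinvW V4 => q; rewrite ltnS leq_eqVlt => /orP[->|->] //=.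
  by rewrite ltn_ord orbT.
apply: (forP (Inv := fun j s4 => ivar s4 17 = i /\ vinv s e sl
    (fun p => (p.1 < i) || (p.1 == i :> nat) && (p.2 < j))%N s4)) => //; last first.
  by move=> s4 v [h17 V4]; split; [rewrite setv_other|apply: vinv_setv].
move=> j s4 hj; rewrite eW in hj => -[h17 V4]; split.
  by rewrite run_ivar ?setv_other.
pose p : I := (Ordinal hi, Ordinal hj).
have V5 := vinv_setv j (mem_last 17 [:: 18]%N) V4.
have := @vinv_step _ _ _ _ _ p he V5 h17 (setv_same _ _ _).
apply: vinvW => q; rewrite ltnS pairE /= (leq_eqVlt q.2).
by do ![case: eqP => //= _ | case: ltnP => //= _].
Qed.

Lemma vector_frame s z : (z < 17)%N -> ivar (run (level_vector L W) s) z = ivar s z.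
Proof.
move=> hz; rewrite run_ivar //.
have /allP h : all (leq 17) (modv (level_vector L W)) by [].
by apply/negP=> /h; rewrite leqNgt hz.
Qed.

(** [S] collects the extensions already treated. Being killed survives later updates, so [S] only
    grows along the three loops. *)
Definition kinv (S : nat -> I -> bool) s : Prop :=
  core s /\ forall e x, (e < D)%N -> S e x -> kills s (stepvec e x).

Lemma kinvW (S S' : nat -> I -> bool) s : (forall e x, S' e x -> S e x) ->
  kinv S s -> kinv S' s.
Proof. by move=> SS [c h]; split=> // e x he /SS; apply: h. Qed.

Lemma kinv_setv S s (x v : nat) : (7 <= x)%N -> x != 12%N -> kinv S s -> kinv S (setv s x v).
Proof. by move=> h1 h2 [c h]; split=> //; apply: core_setv. Qed.

Lemma kinv_step S s e x : (e < D)%N -> kinv S s ->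
  ivar s 14 = e -> ivar s 15 = val x.1 -> ivar s 16 = val x.2 ->
  kinv (fun e' x' => S e' x' || (e' == e) && (x' == x)) (run (level_vector L W) s).
Proof.
move=> he [c h] h14 h15 h16; have [c' m k] := vector_ok c h14 h15 h16 he.
by split=> // e' x' he' /orP[hS|/andP[/eqP -> /eqP ->]] //; apply: m; apply: h.
Qed.

Lemma loops_ok s : core s ->
  kinv (fun _ _ => true) (run (PFor 14 4 (PFor 15 L (PFor 16 W (level_vector L W)))) s).
Proof.
move=> c; have eD : ivar s 4 = D by apply: core_low.
suff : kinv (fun e _ => e < ivar s 4)%N
    (run (PFor 14 4 (PFor 15 L (PFor 16 W (level_vector L W)))) s).
  by rewrite eD => -[c' h]; split=> // e x he _; apply: h.
apply: (forP (Inv := fun i => kinv (fun e _ => e < i)%N)) => //; last first.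
  by move=> s1 v; apply: kinv_setv.
move=> e s1 he; rewrite eD in he => K1.
have {K1} : ivar (setv s1 14 e) 14 = e /\ kinv
    (fun e' x => (e' < e) || (e' == e) && (x.1 < 0))%N (setv s1 14 e).
  split; first exact: setv_same.
  by apply: kinv_setv => //; apply: kinvW K1 => e' x; rewrite andbF orbF.
move: (setv s1 14 e) => s2 K2.
have eL : ivar s2 L = n1 by have [_ [c4 _]] := K2; apply: core_low.
suff : ivar (run (PFor 15 L (PFor 16 W (level_vector L W))) s2) 14 = e /\ kinv
    (fun e' x => (e' < e) || (e' == e) && (x.1 < ivar s2 L))%N
    (run (PFor 15 L (PFor 16 W (level_vector L W))) s2).
  rewrite eL => -[_ K]; apply: kinvW K => e' x; rewrite ltnS leq_eqVlt => /orP[->|->] //=.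
  by rewrite ltn_ord orbT.
apply: (forP (Inv := fun i s3 => ivar s3 14 = e /\ kinv
    (fun e' x => (e' < e) || (e' == e) && (x.1 < i))%N s3)) => //; last first.
  by move=> s3 v [h14 K]; split; [rewrite setv_other|apply: kinv_setv].
move=> i s3 hi; rewrite eL in hi => -[h14 K3].
have {K3} : [/\ ivar (setv s3 15 i) 14 = e, ivar (setv s3 15 i) 15 = i & kinv
    (fun e' x => (e' < e) || (e' == e) && ((x.1 < i) || (x.1 == i :> nat) && (x.2 < 0)))%N
    (setv s3 15 i)].
  split; [by rewrite setv_other|exact: setv_same|].
  by apply: kinv_setv => //; apply: kinvW K3 => e' x; rewrite andbF orbF.
move: (setv s3 15 i) => s4 K4.
have eW : ivar s4 W = n2 by have [_ _ [c4 _]] := K4; apply: core_low.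
suff : [/\ ivar (run (PFor 16 W (level_vector L W)) s4) 14 = e,
    ivar (run (PFor 16 W (level_vector L W)) s4) 15 = i & kinv
    (fun e' x => (e' < e) || (e' == e) && ((x.1 < i) || (x.1 == i :> nat) && (x.2 < ivar s4 W)))%N
    (run (PFor 16 W (level_vector L W)) s4)].
  rewrite eW => -[h _ K]; split; first by [].
  apply: kinvW K => e' x; rewrite (ltnS x.1) (leq_eqVlt x.1) (ltn_ord x.2) andbT.
  by rewrite (orbC (x.1 == i :> nat)).
apply: (forP (Inv := fun j s5 => [/\ ivar s5 14 = e, ivar s5 15 = i & kinv
    (fun e' x => (e' < e) || (e' == e) && ((x.1 < i) || (x.1 == i :> nat) && (x.2 < j)))%N
    s5])) => //; last first.
  by move=> s5 v [g14 g15 K]; split; [rewrite setv_other|rewrite setv_other|apply: kinv_setv].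
move=> j s5 hj; rewrite eW in hj => -[g14 g15 K5].
split; [by rewrite vector_frame // setv_other|by rewrite vector_frame // setv_other|].
have K6 := @kinv_setv _ _ 16 j (isT : (7 <= 16)%N) (isT : 16 != 12%N) K5.
pose x : I := (Ordinal hi, Ordinal hj).
have := @kinv_step _ _ _ x he K6 g14 g15 (setv_same _ _ _).
apply: kinvW => e' x'; rewrite pairE /= ltnS (leq_eqVlt x'.2).
by do ![case: eqP => //= _ | case: ltnP => //= _].
Qed.

Lemma init_ok : core (run (level_init L W) s0).
Proof.
rewrite /level_init.
rewrite run_PSeq; move E1 : (run (tab 6 _ _) s0) => s1.
rewrite run_PSeq; move E2 : (run (tab 7 _ _) s1) => s2.
rewrite run_PSeq; move E3 : (run (tab 8 _ _) s2) => s3.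
move E4 : (run (tab 5 _ _) s3) => s4.
have gb4 : good_binders (pairs2 L W) by rewrite /good_binders /= hL hW.
have gb5 : good_binders (slotvars L W) by rewrite /good_binders /= hL hW.
have L20 : (L < 20)%N by rewrite (ltn_trans hL).
have W20 : (W < 20)%N by rewrite (ltn_trans hW).
have i1 z : (z < 20)%N -> ivar s1 z = ivar s0 z by move=> hz; rewrite -E1 tab_low.
have i2 z : (z < 20)%N -> ivar s2 z = ivar s0 z by move=> hz; rewrite -E2 tab_low ?i1.
have i3 z : (z < 20)%N -> ivar s3 z = ivar s0 z by move=> hz; rewrite -E3 tab_low ?i2.
have i4 z : (z < 20)%N -> ivar s4 z = ivar s0 z by move=> hz; rewrite -E4 tab_low ?i3.
have g1 (z : nat) : z != 6%N -> farr s1 z = farr s0 z by move=> h; rewrite -E1 tab_farr.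
have g2 (z : nat) : z != 7%N -> farr s2 z = farr s1 z by move=> h; rewrite -E2 tab_farr.
have g3 (z : nat) : z != 8%N -> farr s3 z = farr s2 z by move=> h; rewrite -E3 tab_farr.
have g4 (z : nat) : z != 5%N -> farr s4 z = farr s3 z by move=> h; rewrite -E4 tab_farr.
have fR (x y : I) : rd4 s4 7 x y = 0.
  by rewrite /rd4 g4 // g3 // -E2 run_tab //= !i1 // !ltn_ord.
have fB (x y : I) : rd4 s4 8 x y = 0.
  by rewrite /rd4 g4 // -E3 run_tab //= !i2 // !ltn_ord.
split.
- split; [|exact: i4|].
    by move=> z hz; rewrite i4 // (ltn_trans hz).
  by move=> a; rewrite !inE => /or3P[] /eqP ->; rewrite g4 // g3 // g2 // g1.
- move=> x y; rewrite big1 ?addr0; last by move=> q _; rewrite fR mul0r.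
  rewrite /rd4 g4 // g3 // g2 // -E1 run_tab //= !ltn_ord /= /upd_var /= pairE.
  by do 2 case: eqP.
- by move=> q; right=> x.
move=> p; left; split=> // v e1 e2 hv he1 he2.
by rewrite -E4 run_tab //= !i3 // !ltn_ord hv he1 he2.
Qed.

Lemma level_ok (s' := run (level L W) s0) :
  [/\ keep s', forall p, slot_ok s' p &
      forall e x y, (e < D)%N -> stepvec e x y =
        \sum_q (\sum_z stepvec e x z * rd4 s' 7 z q) * rd4 s' 8 q y].
Proof.
rewrite /s' /level run_PSeq; have := loops_ok init_ok.
move: (run (PFor 14 _ _) _) => s [[k c1 c2 c3] h].
split=> // e x y he; have := h e x he isT y.
under eq_bigr => q _.
  rewrite (_ : rd4 s 6 q y = (q == y)%:R - \sum_t rd4 s 7 q t * rd4 s 8 t y); last first.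
    by rewrite -c1 addrK.
  rewrite mulrBr; over.
rewrite sumrB (bigD1 y) //= eqxx mulr1 big1 ?addr0; last first.
  by move=> q /negbTE ->; rewrite mulr0.
move/eqP; rewrite subr_eq0 => /eqP ->.
under eq_bigr do rewrite mulr_sumr.
rewrite exchange_big /=; apply: eq_bigr => q _; rewrite mulr_suml.
by apply: eq_bigr => t _; rewrite mulrA.
Qed.

End Level.

(** * Testing a combination of restrictions for zero *)

Section Suffix.
Variables (F : fieldType) (w D : nat).
Variables (N : nat -> nat -> nat -> nat -> F) (o : nat -> nat).
Implicit Types (G : nat -> nat -> nat -> F) (m : nat -> nat).

(* Coefficient at [m] of the last [j] layers, from state [q] at layer [i], after
   the substitution [G]; for [i = 0] and [j = n] it is that of the polynomial. *)
Fixpoint suf G m (j i q : nat) : F :=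
  if j is j'.+1 then
    \sum_(q' < w) (\sum_(e < D) N i q q' e * G (o i) (m (o i)) e) * suf G m j' i.+1 q'
  else (q == 0%N)%:R.

Definition setm m v e : nat -> nat := fun v' => if v' == v then e else m v'.

Definition fixG G v e : nat -> nat -> nat -> F :=
  fun v' e1 e2 => if v' == v then G v' e e2 else G v' e1 e2.

Lemma suf_ext G G' m m' j i q :
  (forall i' e, (i <= i' < i + j)%N -> (e < D)%N ->
     G (o i') (m (o i')) e = G' (o i') (m' (o i')) e) ->
  suf G m j i q = suf G' m' j i q.
Proof.
elim: j i q => //= j IH i q E; apply: eq_bigr => q' _; congr (_ * _).
  by apply: eq_bigr => e _; rewrite E //; lia.
by apply: IH => i' e hi he; apply: E => //; lia.
Qed.

(** A fixed variable reads row [e] of its table whatever exponent is requested, which amounts to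
    requesting [e]. The layers are not touched, so fixing works for variables at any position of the
    order. *)
Lemma suf_fixG G m v e j i q : suf (fixG G v e) m j i q = suf G (setm m v e) j i q.
Proof.
by apply: suf_ext => i' e' _ _; rewrite /fixG /setm; case: eqP => // ->.
Qed.

(** Associativity, block by block: a layer may be applied to the prefix vector or to the suffix. *)
Lemma suf_step n1 (T : nat -> nat -> nat -> F) (C : nat -> nat -> F) (S : nat -> nat -> F) :
  \sum_(y : 'I_n1 * 'I_w) (\sum_(q < w) C y.1 q * T y.1 q y.2) * S y.1 y.2 =
  \sum_(y : 'I_n1 * 'I_w) C y.1 y.2 * \sum_(q < w) T y.1 y.2 q * S y.1 q.
Proof.
rewrite -(pair_bigA _ (fun (a : 'I_n1) (b : 'I_w) =>
  (\sum_(q < w) C a q * T a q b) * S a b)) /=.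
rewrite -(pair_bigA _ (fun (a : 'I_n1) (b : 'I_w) =>
  C a b * \sum_(q < w) T a b q * S a q)) /=.
apply: eq_bigr => a _; under eq_bigr do rewrite mulr_suml.
rewrite exchange_big /=; apply: eq_bigr => b _; rewrite mulr_sumr.
by apply: eq_bigr => q _; rewrite mulrA.
Qed.

End Suffix.

Section Verdict.
Variable F : fieldType.
Implicit Type s : state F.

(* Variable 7 carries the answer; once cleared, it is never set again. *)
Definition verdict s s' (Q : Prop) : Prop :=
  (ivar s' 7 = ivar s 7 /\ Q) \/ (ivar s' 7 = 0%N /\ ~ Q).

Lemma verdict_trans s1 s2 s3 P Q :
  verdict s1 s2 P -> verdict s2 s3 Q -> verdict s1 s3 (P /\ Q).
Proof.
case=> [[h1 p]|[h1 p]] [[h2 q]|[h2 q]]; rewrite /verdict h2 ?h1.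
- by left.
- by right; split=> // -[].
- by right; split=> // -[].
- by right; split=> // -[].
Qed.

Lemma verdict_iff s s' P Q : (P <-> Q) -> verdict s s' P -> verdict s s' Q.
Proof. by move=> PQ [[h p]|[h p]]; [left|right]; rewrite -PQ. Qed.

Lemma verdict_for (K : state F -> Prop) x N p s (Q : nat -> Prop) :
  x != 7%N -> (forall s1 v, K s1 -> K (setv s1 x v)) -> K s ->
  (forall i s1, (i < ivar s N)%N -> K s1 -> ivar s1 x = i ->
     K (run p s1) /\ verdict s1 (run p s1) (Q i)) ->
  K (run (PFor x N p) s) /\
  verdict s (run (PFor x N p) s) (forall i, (i < ivar s N)%N -> Q i).
Proof.
move=> hx Kx K0 H.
apply: (forP (Inv := fun k s1 => K s1 /\ verdict s s1 (forall i, (i < k)%N -> Q i))).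
- by split=> //; left.
- move=> k s1 hk [K1 V1].
  have [K2 V2] := H k _ hk (Kx s1 k K1) (setv_same _ _ _).
  have {}V2 : verdict s1 (run p (setv s1 x k)) (Q k).
    by move: V2; rewrite /verdict setv_other // eq_sym.
  split=> //; apply: verdict_iff (verdict_trans V1 V2).
  split=> [[h1 h2] i|h]; last by split=> [i hi|]; apply: h => //; apply: ltnW.
  by rewrite ltnS leq_eqVlt => /predU1P[-> //|]; apply: h1.
- move=> s1 v [K1 V1]; split; first exact: Kx.
  by move: V1; rewrite /verdict setv_other // eq_sym.
Qed.

End Verdict.

Section LevelSpec.
Variable F : fieldType.
Implicit Type s : state F.

Definition stepv n1 n2 s (e : nat) (x y : 'I_n1 * 'I_n2) : F :=
  \sum_(q < n2) farr s 2 [:: val x.1; val x.2; val y.1; val q] *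
                farr s 3 [:: e; val y.1; val q; val y.2].

(** One specification covers both uses: a single block for the first program, and [wA + 1] blocks
    for the test of a relation. *)
Lemma level_spec n1 n2 n D L W s (s' := run (level L W) s) :
  (L < 7)%N -> (W < 7)%N ->
  ivar s L = n1 -> ivar s W = n2 -> ivar s 0 = n -> ivar s 4 = D ->
  (forall p : 'I_n1 * 'I_n2,
     ((forall y, rd4 s' 8 p y = 0) /\
      (forall v e1 e2, (v < n)%N -> (e1 < D)%N -> (e2 < D)%N ->
         farr s' 5 [:: val p.1; val p.2; v; e1; e2] = 0)) \/
     exists e (x : 'I_n1 * 'I_n2), [/\ (e < D)%N, forall y, rd4 s' 8 p y = stepv s e x y &
      (forall v e1 e2, (v < n)%N -> (e1 < D)%N -> (e2 < D)%N ->
         farr s' 5 [:: val p.1; val p.2; v; e1; e2] =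
         fixG (fun v e1 e2 => farr s 4 [:: val x.1; val x.2; v; e1; e2])
           (ivar s 12) e v e1 e2)]) /\
  (forall e (x y : 'I_n1 * 'I_n2), (e < D)%N -> stepv s e x y =
     \sum_q (\sum_z stepv s e x z * rd4 s' 7 z q) * rd4 s' 8 q y).
Proof.
move=> hL hW E1 E2 E3 E4; subst; by have [_ h1 h2] := level_ok s hL hW.
Qed.

End LevelSpec.

Local Open Scope nat_scope.

(** Here the substitutions act: one layer of the second program yields a different matrix in each
    block, and the direct sum is then treated as an ordinary ROABP. *)
Definition load_B : prog :=
  tab 3 [:: (20, 4); (21, 6); (22, 3); (23, 3)]
    (TSum 100 4 (cell 1 [:: 11; 22; 23; 100] *t cell 18 [:: 21; 12; 20; 100])).

Definition check_step : prog :=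
  PSeq (PLoad 12 1 [:: IVar 11])
  (PSeq load_B (PSeq (level 6 3) (tab 2 (pairs2 6 3) (cell 8 [:: 20; 21; 22; 23])))).

Definition check_init : prog :=
  tab 2 (pairs2 6 3)
    (TIf (IVar 20) (INum 0) (TIf (IVar 21) (INum 0) (TIf (IVar 23) (INum 0)
      (cell 19 [:: 22]) TZero) TZero) TZero).

Definition check_final : prog :=
  PFor 17 6 (PFor 18 3
    (PIf (TSum 100 6 (TCell 2 [:: IVar 17; IVar 18; IVar 100; INum 0]))
       (PSet 7 (INum 0)))).

(* Decides whether the combination with coefficients [c_l] (array 19) of the
   polynomials obtained from the second program by the substitutions [G_l]
   (array 18) vanishes: the spanning sets are those of the direct sum of the
   blocks [l]. *)
Definition check : prog :=
  PSeq check_init (PSeq (PFor 11 0 check_step) check_final).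

Local Open Scope ring_scope.

Section Check.
Variables (F : fieldType) (n D n1 n2 : nat).
Variables (N : nat -> nat -> nat -> nat -> F) (o : nat -> nat).
Hypothesis o_lt : forall i, (i < n)%N -> (o i < n)%N.
Hypothesis o_inj : forall i j, (i < n)%N -> (j < n)%N -> o i = o j -> i = j.
Hypotheses (D_gt0 : (0 < D)%N) (n1_gt0 : (0 < n1)%N) (n2_gt0 : (0 < n2)%N).
Implicit Types (s : state F) (m : nat -> nat).
Local Notation I := ('I_n1 * 'I_n2)%type.
Local Notation sufB := (suf n2 D N o).

Definition benv s : Prop :=
  [/\ [/\ ivar s 0 = n, ivar s 4 = D, ivar s 6 = n1 & ivar s 3 = n2],
      forall i q q' e, farr s 1 [:: i; q; q'; e] = N i q q' e &
      forall i, iarr s 1 [:: i] = o i].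

Definition G2 s (l : nat) : nat -> nat -> nat -> F :=
  fun v e1 e2 => farr s 18 [:: l; v; e1; e2].

Definition box m : Prop := forall v, (m v < D)%N.

Definition vanish s (i : nat) : Prop :=
  forall (p : I) m, box m ->
    \sum_(y : I) rd4 s 2 p y * sufB (G2 s y.1) m (n - i) i y.2 = 0.

(** Each new slot is zero or an extension of an old one, which gives one direction. Conversely the
    exponent [m (o i)] selects an extension of the old slot, and that extension is a combination of
    the new slots. *)
Lemma check_step_ok s i (s' := run check_step s) :
  benv s -> (i < n)%N -> ivar s 11 = i -> vanish s i <-> vanish s' i.+1.
Proof.
move=> [[e0 e4 e6 e3] eN eo] hi h11.
rewrite /s' /check_step run_PSeq; move E1 : (run (PLoad _ _ _) s) => s1.
rewrite run_PSeq; move E2 : (run load_B s1) => s2.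
rewrite run_PSeq; move E3 : (run (level 6 3) s2) => s3.
move E4 : (run (tab 2 _ _) s3) => s4.
have i1 z : z != 12%N -> ivar s1 z = ivar s z by move=> h; rewrite -E1 setv_other.
have v1 : ivar s1 12 = o i by rewrite -E1 setv_same /= h11 eo.
have f1 : farr s1 = farr s by rewrite -E1.
have i2 z : (z < 20)%N -> ivar s2 z = ivar s1 z by move=> h; rewrite -E2 tab_low.
have g2 (a : nat) : a != 3%N -> farr s2 a = farr s a.
  by move=> h; rewrite -E2 tab_farr // f1.
have g3 (a : nat) : a \notin moda (level 6 3) -> farr s3 a = farr s2 a.
  by move=> h; rewrite -E3 run_farr.
have g4 (a : nat) : a != 2%N -> farr s4 a = farr s3 a.
  by move=> h; rewrite -E4 tab_farr.
have i3 z : (z < 7)%N -> ivar s3 z = ivar s z.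
  move=> hz; rewrite -E3 run_bound // i2 ?(ltn_trans hz) // i1 //.
  by apply: contraTneq hz => ->.
have f4 (p y : I) : rd4 s4 2 p y = rd4 s3 8 p y.
  rewrite /rd4 -E4 run_tab //= !i3 // e6 e3 !ltn_ord /=.
  by rewrite /upd_var.
have G4 l : G2 s4 l = G2 s l by rewrite /G2 g4 // g3 // g2.
have fT e l q q' : (e < D)%N -> (l < n1)%N -> (q < n2)%N -> (q' < n2)%N ->
    farr s2 3 [:: e; l; q; q'] = \sum_(e' < D) N i q q' e' * G2 s l (o i) e e'.
  move=> he hl hq hq'; rewrite -E2 run_tab // [inbox _ _ _]/= !i1 // e4 e6 e3 he hl hq hq'.
  rewrite (@teval_sum1 _ _ _ _ D); last by rewrite /= !upd_low // i1.
  by apply: eq_bigr => e' _; rewrite /= /upd_var /= i1 // h11 v1 f1 eN.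
have [hA hB] := @level_spec F n1 n2 n D 6 3 s2 isT isT
  (etrans (i2 6 isT) (etrans (i1 6%N isT) e6)) (etrans (i2 3 isT) (etrans (i1 3%N isT) e3))
  (etrans (i2 0 isT) (etrans (i1 0%N isT) e0)) (etrans (i2 4 isT) (etrans (i1 4%N isT) e4)).
rewrite E3 in hA hB.
(* Extending by [e] means requesting exponent [e] for [o i]. The later layers do not notice this
   change of [m], because [o] is injective. *)
have key e (p : I) m : (e < D)%N ->
    \sum_(y : I) stepv s2 e p y * sufB (G2 s y.1) m (n - i.+1) i.+1 y.2 =
    \sum_(y : I) rd4 s 2 p y * sufB (G2 s y.1) (setm m (o i) e) (n - i) i y.2.
  move=> he; have -> : (n - i = (n - i.+1).+1)%N by lia.
  rewrite (@suf_step _ _ n1 (fun l q q' => farr s2 3 [:: e; l; q; q'])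
    (fun l q => farr s2 2 [:: val p.1; val p.2; l; q])
    (fun l q => sufB (G2 s l) m (n - i.+1) i.+1 q)).
  apply: eq_bigr => y _; rewrite g2 //; congr (_ * _) => /=.
  apply: eq_bigr => q' _; rewrite fT //; congr (_ * _).
    by rewrite /setm eqxx.
  apply: suf_ext => i' e' hi' he'; rewrite /setm; case: eqP => // E.
  by have := o_inj _ _ E; lia.
split=> V p m bm.
  case: (hA p) => [[h _]|[e [x [he hv _]]]].
    by rewrite big1 // => y _; rewrite f4 h mul0r.
  under eq_bigr do rewrite f4 hv G4.
  rewrite key //; apply: V => v; rewrite /setm; by case: eqP.
transitivity (\sum_(y : I) rd4 s 2 p y * sufB (G2 s y.1) (setm m (o i) (m (o i))) (n - i) i y.2).
  apply: eq_bigr => y _; congr (_ * _); apply: suf_ext => i' e _ _.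
  by rewrite /setm; case: eqP => // ->.
rewrite -key; last exact: bm.
under eq_bigr => y _ do [rewrite hB; last exact: bm].
under eq_bigr do rewrite mulr_suml.
rewrite exchange_big /= big1 // => q _; under eq_bigr do rewrite -mulrA.
rewrite -mulr_sumr -[RHS](mulr0 (\sum_z stepv s2 (m (o i)) p z * rd4 s3 7 z q)).
congr (_ * _); rewrite -[RHS](V q m bm); apply: eq_bigr => y _.
by rewrite f4 G4.
Qed.

Lemma benv_frame p s : pwf p -> 1%N \notin moda p -> benv s -> benv (run p s).
Proof.
move=> wp hp [[e0 e4 e6 e3] eN eo].
by split; [rewrite !run_bound|move=> *; rewrite run_farr|move=> *; rewrite run_iarr].
Qed.

Lemma benv_setv s (x v : nat) : (7 <= x)%N -> benv s -> benv (setv s x v).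
Proof.
move=> hx [[e0 e4 e6 e3] eN eo]; split=> //.
by rewrite /= !upd_low.
Qed.

Lemma check_ok s (s' := run check s) : benv s ->
  verdict s s' (forall m, box m -> \sum_(l < n1) farr s 19 [:: val l] * sufB (G2 s l) m n 0 0 = 0).
Proof.
move=> bs; rewrite /s' /check.
rewrite run_PSeq; move E1 : (run check_init s) => s1.
have b1 : benv s1 by rewrite -E1; apply: benv_frame.
have v1 : ivar s1 7 = ivar s 7 by rewrite -E1 run_ivar.
have G1 l : G2 s1 l = G2 s l by rewrite /G2 -E1 run_farr.
have [[e0 e4 e6 e3] eN eo] := bs.
have V1 : vanish s1 0 <->
    forall m, box m -> \sum_(l < n1) farr s 19 [:: val l] * sufB (G2 s l) m n 0 0 = 0.
  (* Slot [(0, 0)] carries the whole combination: it starts block [l] in state 0 with weight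
     [c_l]. *)
  have f1 (p y : I) : rd4 s1 2 p y =
      if [&& p.1 == 0 :> nat, p.2 == 0 :> nat & y.2 == 0 :> nat]%N
      then farr s 19 [:: val y.1] else 0.
    rewrite /rd4 -E1 /check_init run_tab //= e6 e3 !ltn_ord /= /upd_var /=.
    by do 3 case: eqP => //=.
  have S m : \sum_(y : I) (if y.2 == 0 :> nat then farr s 19 [:: val y.1] else 0) *
      sufB (G2 s y.1) m n 0 y.2 = \sum_(l < n1) farr s 19 [:: val l] * sufB (G2 s l) m n 0 0.
    rewrite -(pair_bigA _ (fun (a : 'I_n1) (b : 'I_n2) => (if b == 0 :> nat then
      farr s 19 [:: val a] else 0) * sufB (G2 s a) m n 0 b)) /=.
    apply: eq_bigr => a _; rewrite (bigD1 (Ordinal n2_gt0)) //= big1 ?addr0 // => b.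
    by rewrite -val_eqE /= => /negbTE ->; rewrite mul0r.
  split=> [V m bm|V p m bm].
    rewrite -S -[RHS](V (Ordinal n1_gt0, Ordinal n2_gt0) m bm) subn0.
    by apply: eq_bigr => y _; rewrite f1 G1.
  rewrite subn0; case: (boolP ((p.1 == 0 :> nat) && (p.2 == 0 :> nat))%N) => [/andP[h1 h2]|h].
    by rewrite -[RHS](V m bm) -S; apply: eq_bigr => y _; rewrite f1 h1 h2 G1.
  rewrite big1 // => y _; rewrite f1; case: ifP; rewrite ?mul0r // => /and3P[h1 h2 _].
  by rewrite h1 h2 in h.
rewrite run_PSeq; move E2 : (run (PFor 11 0 check_step) s1) => s2.
have [b2 V2 v2] : [/\ benv s2, vanish s1 0 <-> vanish s2 n & ivar s2 7 = ivar s 7].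
  have eN1 : ivar s1 0 = n by case: b1 => -[].
  rewrite -E2 -eN1; apply: (forP (Inv := fun i s3 =>
    [/\ benv s3, vanish s1 0 <-> vanish s3 i & ivar s3 7 = ivar s 7])) => //.
    move=> i s3; rewrite eN1 => hi [b3 V3 v3].
    have b3' : benv (setv s3 11 i) by apply: benv_setv.
    split; [exact: benv_frame| |by rewrite run_ivar ?setv_other].
    by rewrite V3 -(check_step_ok b3' hi (setv_same _ _ _)).
(* After the last layer a suffix is 1 at state 0 and 0 at the other states, so a vector contributes
   the sum of its state-0 coordinates over the blocks. *)
pose Q p1 p2 := \sum_(l < n1) farr s2 2 [:: p1; p2; val l; 0%N] = 0.
have VQ : vanish s2 n <-> forall p1, (p1 < n1)%N -> forall p2, (p2 < n2)%N -> Q p1 p2.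
  have S (p : I) m : \sum_(y : I) rd4 s2 2 p y * sufB (G2 s2 y.1) m (n - n) n y.2 =
      \sum_(l < n1) farr s2 2 [:: val p.1; val p.2; val l; 0%N].
    rewrite subnn /= -(pair_bigA _ (fun (a : 'I_n1) (b : 'I_n2) =>
      farr s2 2 [:: val p.1; val p.2; val a; val b] * (b == 0 :> nat)%N%:R)) /=.
    apply: eq_bigr => a _; rewrite (bigD1 (Ordinal n2_gt0)) //= big1 ?addr0 ?mulr1 // => b.
    by rewrite -val_eqE /= => /negbTE ->; rewrite mulr0.
  split=> [V p1 h1 p2 h2|V p m bm]; last by rewrite S; exact: (V _ (ltn_ord p.1) _ (ltn_ord p.2)).
  by have := V (Ordinal h1, Ordinal h2) (fun=> 0%N) (fun=> D_gt0); rewrite S.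
have e62 : ivar s2 6 = n1 by case: b2 => -[].
suff V3 : verdict s2 (run check_final s2)
    (forall p1, (p1 < ivar s2 6)%N -> forall p2, (p2 < n2)%N -> Q p1 p2).
  rewrite e62 in V3.
  have := verdict_iff (iff_trans (iff_sym VQ) (iff_trans (iff_sym V2) V1)) V3.
  rewrite /verdict v2. done.
pose K s3 := benv s3 /\ farr s3 2 = farr s2 2.
have Kset s3 (x v : nat) : (7 <= x)%N -> K s3 -> K (setv s3 x v).
  by move=> hx [b E]; split=> //; apply: benv_setv.
apply: (proj2 (@verdict_for _ K 17%N 6%N _ s2 _ _ _ _ _)) => //.
move=> p1 s3 h1 K3 h17; rewrite e62 in h1.
have e32 : ivar s3 3 = n2 by case: K3 => -[[]].
move E3 : (run _ s3) => s4.
suff [[K4 _] V4] : (K s4 /\ ivar s4 17 = p1) /\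
    verdict s3 s4 (forall p2, (p2 < ivar s3 3)%N -> Q p1 p2) by rewrite e32 in V4.
rewrite -E3 {E3}.
apply: (@verdict_for _ (fun s4 => K s4 /\ ivar s4 17 = p1)) => //.
move=> p2 s5 h2 [K4 h4] h18; rewrite e32 in h2.
rewrite run_PIf (@teval_sum1 _ _ _ _ n1); last by case: K4 => -[[]].
under eq_bigr => l _ do rewrite [teval _ _]/= /upd_var /= h4 h18 (proj2 K4).
case: eqP => Z.
  by split=> //; left.
split; first by split; [apply: Kset|rewrite setv_other].
right; split; first exact: setv_same.
exact: Z.
Qed.
End Check.

(** * Coefficients of an ROABP *)

Definition idG (F : fieldType) : nat -> nat -> nat -> F := fun _ e1 e2 => (e1 == e2)%:R.

Section Coefficients.
Variables (F : fieldType) (n : nat).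
Implicit Types (p : {mpoly F[n]}) (m : 'X_{1..n}) (v : 'I_n).

Definition zap m v : 'X_{1..n} := [multinom (if i == v then 0 else m i)%N | i < n].

(** The hypothesis says that [p] is free of [x_v], so the exponent of [x_v] comes from the new
    factor alone. This is where reading each variable once enters. *)
Lemma mcoeff_mulXn p v j m :
  (forall m', m' v != 0%N -> p@_m' = 0) ->
  (p * 'X_v ^+ j)@_m = if m v == j then p@_(zap m v) else 0.
Proof.
move=> hp; rewrite mpolyXn.
have [<-|ne] := eqVneq (m v) j.
  rewrite -(mcoeffMX p (U_(v) *+ m v)%MM (zap m v)); congr (_@__).
  apply/mnmP=> i; rewrite mnmDE mulmnE mnm1E mnmE eq_sym.
  by case: (eqVneq v i) => [->|]; rewrite ?mul1n ?mul0n ?addn0.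
case: (boolP (U_(v) *+ j <= m)%MM) => h.
  rewrite -[in LHS](submK h) addmC mcoeffMX hp // mnmBE mulmnE mnm1E eqxx mul1n.
  have := mnm_lepP h v; rewrite mulmnE mnm1E eqxx mul1n => hj.
  by move: ne; lia.
apply/eqP; rewrite mcoeff_eq0 (perm_mem (msuppMX _ _)); apply/mapP=> -[m' _ E].
by move: h; rewrite E lem_addr.
Qed.

Lemma mcoeff_mul_horner p v (f : {poly F}) m :
  (forall m', m' v != 0%N -> p@_m' = 0) ->
  (p * horner_alg 'X_v f)@_m = p@_(zap m v) * f`_(m v).
Proof.
move=> hp; rewrite -{1}[f]coefK poly_def raddf_sum /= mulr_sumr raddf_sum /=.
under eq_bigr => i _.
  rewrite linearZ /= rmorphXn /= horner_algX mulr_algl -scalerAr mcoeffZ mcoeff_mulXn //.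
  over.
have [h|h] := ltnP (m v) (size f).
  rewrite (bigD1 (Ordinal h)) //= eqxx mulrC big1 ?addr0 // => i.
  by rewrite -val_eqE /= eq_sym => /negbTE ->; rewrite mulr0.
rewrite nth_default // mulr0 big1 // => i _.
case: eqP => [E|_]; last by rewrite mulr0.
by rewrite E leqNgt ltn_ord in h.
Qed.

End Coefficients.

Section RoabpCoef.
Variables (F : fieldType) (n w : nat) (A : roabp F n w).
Hypothesis w_gt0 : (0 < w)%N.
Local Notation N := (roabp_coef A).
Local Notation o := (roabp_order A).

Lemma roabp_orderE (i : 'I_n) : o i = Defs.order A i.
Proof. by rewrite /roabp_order valK. Qed.

Lemma roabp_order_lt i : (i < n)%N -> (o i < n)%N.
Proof. by move=> hi; rewrite -[i]/(val (Ordinal hi)) roabp_orderE. Qed.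

Lemma roabp_order_inj i j : (i < n)%N -> (j < n)%N -> o i = o j -> i = j.
Proof.
move=> hi hj; rewrite -[i]/(val (Ordinal hi)) -[j]/(val (Ordinal hj)) !roabp_orderE.
by move=> /val_inj /perm_inj ->.
Qed.

Lemma bdim_le k : (bdim n w k <= w)%N.
Proof. by rewrite /bdim; case: ifP. Qed.

Lemma roabp_coefE (i : 'I_n) (r : 'I_(bdim n w i)) (c : 'I_(bdim n w i.+1)) k :
  N i r c k = (layer A i r c)`_k.
Proof. by rewrite /roabp_coef !valK. Qed.

Lemma roabp_coef_row (i : 'I_n) r c k : (bdim n w i <= r)%N -> N i r c k = 0.
Proof. by move=> h; rewrite /roabp_coef valK insubF // ltnNge h. Qed.

(** The sum runs over all [w] states at every level: coefficients outside the true dimensions are 0,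
    so the 1-row and 1-column boundary matrices need no separate case. *)
Fixpoint pre (m : nat -> nat) (k q : nat) : F :=
  if k is k'.+1 then \sum_(q' < w) pre m k' q' * N k' q' q (m (o k'))
  else (q == 0%N)%:R.

Lemma pre_ext m m' k q : (forall i, (i < k)%N -> m (o i) = m' (o i)) ->
  pre m k q = pre m' k q.
Proof.
elim: k q => //= k IH q E; apply: eq_bigr => q' _; rewrite E //.
by rewrite IH // => i hi; apply: E; apply: ltnW.
Qed.

(** The product of prefix and suffix vectors is the same at every cut [k]; the cuts [n] and [0] give
    the two sides. *)
Lemma pre_suf D m : (forall v, m v < D)%N ->
  pre m n 0 = suf w D N o (@idG F) m n 0 0.
Proof.
move=> bm; pose S k := \sum_(q < w) pre m k q * suf w D N o (@idG F) m (n - k) k q.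
have S0 : S 0%N = suf w D N o (@idG F) m n 0 0.
  rewrite /S subn0 (bigD1 (Ordinal w_gt0)) //= mul1r big1 ?addr0 // => q.
  by rewrite -val_eqE /= => /negbTE ->; rewrite mul0r.
have Sn : S n = pre m n 0.
  rewrite /S subnn (bigD1 (Ordinal w_gt0)) //= mulr1 big1 ?addr0 // => q.
  by rewrite -val_eqE /= => /negbTE ->; rewrite mulr0.
suff St k : (k < n)%N -> S k.+1 = S k.
  rewrite -Sn -S0; have H k : (k <= n)%N -> S k = S 0%N.
    by elim: k => // k IH hk; rewrite St // IH // ltnW.
  exact: H.
move=> hk; rewrite /S (_ : (n - k = (n - k.+1).+1)%N); last by rewrite subnSK.
under [RHS]eq_bigr => q _ do rewrite /= mulr_sumr.
rewrite exchange_big /=; apply: eq_bigr => q' _; rewrite mulr_suml.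
apply: eq_bigr => q _; rewrite mulrA; congr (_ * _ * _).
rewrite (bigD1 (Ordinal (bm (o k)))) //= /idG eqxx mulr1 big1 ?addr0 // => e.
by rewrite -val_eqE /= eq_sym => /negbTE ->; rewrite mulr0.
Qed.

Definition mval (m : 'X_{1..n}) (v : nat) : nat := if insub v is Some i then m i else 0%N.

Lemma mval_ord m (v : 'I_n) : mval m v = m v.
Proof. by rewrite /mval valK. Qed.

Definition unread k (m : 'X_{1..n}) : bool :=
  [forall i : 'I_n, (k <= i)%N ==> (m (Defs.order A i) == 0%N)].

(** The support condition is carried along because the induction step needs it: it says that the
    variable of layer [k] has not occurred before. *)
Lemma prefix_coef k (h : (k <= n)%N) m r q :
  (prefix_prod A h r q)@_m = if unread k m then pre (mval m) k q else 0.
Proof.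
rewrite (ord1 r) {r}; elim: k h m q => [|k IH] h m q.
  rewrite /= mxE (ord1 q) eqxx mcoeff1; case: ifP => [/forallP U|/negbT].
    case: eqP => // H; case: H; apply/mnmP=> i; rewrite mnm0E.
    by have := U ((Defs.order A)^-1 i)%g; rewrite permKV => /eqP.
  case: eqP => // -> /negP H; case: H; apply/forallP=> i.
  by rewrite mnm0E eqxx implybT.
set i := Ordinal h.
rewrite [prefix_prod _ _]/= mxE raddf_sum /=.
under eq_bigr => q' _.
  rewrite mxE mcoeff_mul_horner; last first.
    move=> m' hm'; rewrite IH; case: ifP => // /forallP/(_ i) /=.
    by rewrite leqnn (negbTE hm').
  rewrite IH -roabp_coefE.
  over.
have Uz : unread k (zap m (Defs.order A i)) = unread k.+1 m.
  apply/forallP/forallP => U j; have := U j; rewrite mnmE (inj_eq perm_inj).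
    by case: (eqVneq j i) => [->|ne]; rewrite ?ltnn //=; case: ltnP => // hj; rewrite (ltnW hj).
  case: (eqVneq j i) => [->|ne]; rewrite ?implybT //=.
  move=> /implyP U'; apply/implyP=> hkj; apply: U'; rewrite ltn_neqAle hkj andbT.
  by apply: contra_neq ne => E; apply: val_inj.
rewrite Uz; case: ifP => _; last by rewrite big1 // => q' _; rewrite mul0r.
rewrite /= (big_ord_widen _ (fun q' => pre (mval (zap m (Defs.order A i))) k q' *
  N i q' q (m (Defs.order A i))) (bdim_le k)) big_mkcond.
apply: eq_bigr => q' _; rewrite -[k in o k]/(val i) roabp_orderE mval_ord.
case: ltnP => hq; last by rewrite (@roabp_coef_row i) ?mulr0.
congr (_ * _); apply: pre_ext => j hj.
have hjn := ltn_trans hj h.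
rewrite -[j]/(val (Ordinal hjn)) roabp_orderE !mval_ord mnmE (inj_eq perm_inj).
by rewrite -val_eqE /= ltn_eqF.
Qed.

(** The coefficient at [m] involves only layer coefficients of degree [m (o i)]. Hence reading
    degrees below [D] is enough even if entries of the matrices have larger degree; the degree bound
    concerns the polynomial only. *)
Lemma roabp_poly_coef D (m : 'X_{1..n}) : (forall i, m i < D)%N -> (0 < D)%N ->
  (roabp_poly A)@_m = suf w D N o (@idG F) (mval m) n 0 0.
Proof.
move=> bm D0; rewrite -pre_suf; last by move=> v; rewrite /mval; case: insub.
rewrite /roabp_poly castmxE prefix_coef ifT.
  by congr pre.
by apply/forallP=> i; rewrite leqNgt ltn_ord.
Qed.

End RoabpCoef.

Lemma roabp_poly_eq (F : fieldType) (n d wA wB : nat) (A : roabp F n wA) (B : roabp F n wB) :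
  (0 < wA)%N -> (0 < wB)%N ->
  individual_degree_le d (roabp_poly A) -> individual_degree_le d (roabp_poly B) ->
  reflect (forall m, box d.+1 m ->
     suf wA d.+1 (roabp_coef A) (roabp_order A) (@idG F) m n 0 0 =
     suf wB d.+1 (roabp_coef B) (roabp_order B) (@idG F) m n 0 0)
    (roabp_poly A == roabp_poly B).
Proof.
move=> hA hB dA dB; apply: (iffP eqP) => [E m bm|E].
  pose mm : 'X_{1..n} := [multinom m i | i < n].
  have bmm i : (mm i < d.+1)%N by rewrite mnmE.
  have := roabp_poly_coef A hA bmm isT; rewrite E (roabp_poly_coef B hB bmm isT) => H.
  have ext w (C : roabp F n w) : suf w d.+1 (roabp_coef C) (roabp_order C) (@idG F) m n 0 0 =
      suf w d.+1 (roabp_coef C) (roabp_order C) (@idG F) (mval mm) n 0 0.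
    apply: suf_ext => i e hi _; have hin : (i < n)%N by [].
    by rewrite -[i]/(val (Ordinal hin)) roabp_orderE mval_ord mnmE.
  by rewrite !ext.
apply/mpolyP=> m.
case: (boolP [forall i, m i < d.+1]%N) => [/forallP bm|].
  rewrite (roabp_poly_coef A hA bm) // (roabp_poly_coef B hB bm) //; apply: E => v.
  by rewrite /mval; case: insub.
(* Outside the box some exponent exceeds [d], and both coefficients vanish by the degree
   hypotheses. *)
case/forallPn=> i; rewrite -leqNgt => hi.
have Z (p : {mpoly F[n]}) : individual_degree_le d p -> p@_m = 0.
  move=> dp; apply/eqP; rewrite mcoeff_eq0; apply/negP=> /dp /(_ i).
  by rewrite leqNgt hi.
by rewrite !Z.
Qed.

(** * The equality test *)

Section Transfer.
Variables (F : fieldType) (n D wA wB k : nat).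
Variables (NA NB : nat -> nat -> nat -> nat -> F) (oA oB : nat -> nat).
Hypothesis oA_lt : forall i, (i < n)%N -> (oA i < n)%N.
Hypothesis oB_lt : forall i, (i < n)%N -> (oB i < n)%N.
Hypothesis oA_inj : forall i j, (i < n)%N -> (j < n)%N -> oA i = oA j -> i = j.
Hypothesis kn : (k < n)%N.
Local Notation sufA := (suf wA D NA oA).
Local Notation sufB := (suf wB D NB oB).
Implicit Types (G : nat -> nat -> nat -> nat -> F) (C : nat -> nat -> F) (m : nat -> nat).

(** [C a] is the prefix vector, after [i] layers, of the monomial that the table [G a] encodes. *)
Definition represents G C (i : nat) : Prop := forall a m, (a < wA)%N -> box D m ->
  sufA (G a) m n 0 0 = \sum_(q < wA) C a q * sufA (@idG F) m (n - i) i q.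

Definition settled G (i : nat) : Prop := forall a j e e' e2,
  (a < wA)%N -> (j < i)%N -> (e < D)%N -> (e' < D)%N -> (e2 < D)%N ->
  G a (oA j) e e2 = G a (oA j) e' e2.

Definition agreeing G : Prop := forall a m, (a < wA)%N -> box D m ->
  sufA (G a) m n 0 0 = sufB (G a) m n 0 0.

Variables (G G' : nat -> nat -> nat -> nat -> F) (C C' : nat -> nat -> F).
Variable gamma : nat -> nat -> nat -> F.

Definition extend (e a q : nat) : F := \sum_(q' < wA) C a q' * NA k q' q e.

Definition bounded (H : nat -> nat -> nat -> F) (H' : nat -> nat -> nat -> F) : Prop :=
  forall v e1 e2, (v < n)%N -> (e1 < D)%N -> (e2 < D)%N -> H v e1 e2 = H' v e1 e2.

Hypothesis slots : forall b, (b < wA)%N ->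
  ((forall q, (q < wA)%N -> C' b q = 0) /\ bounded (G' b) (fun _ _ _ => 0)) \/
  exists e a, [/\ (e < D)%N, (a < wA)%N, forall q, (q < wA)%N -> C' b q = extend e a q &
    bounded (G' b) (fixG (G a) (oA k) e)].
Hypothesis decomp : forall e a q, (e < D)%N -> (a < wA)%N -> (q < wA)%N ->
  extend e a q = \sum_(b < wA) gamma a e b * C' b q.

Lemma setm_box m v e : (e < D)%N -> box D m -> box D (setm m v e).
Proof. by move=> he bm v'; rewrite /setm; case: eqP. Qed.

Lemma suf_bounded w (N : nat -> nat -> nat -> nat -> F) o (H H' : nat -> nat -> nat -> F) m q :
  (forall i, (i < n)%N -> (o i < n)%N) -> box D m -> bounded H H' ->
  suf w D N o H m n 0 q = suf w D N o H' m n 0 q.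
Proof.
move=> ho bm E; apply: suf_ext => i e hi he; apply: E => //; exact: ho.
Qed.

Lemma suf_zero w (N : nat -> nat -> nat -> nat -> F) o m q :
  suf w D N o (fun _ _ _ => 0) m n 0 q = 0.
Proof.
(* The zero table needs a layer to act on: without layers the value at state 0 would be 1. *)
case: n kn => // n' _ /=; rewrite big1 // => q' _.
by rewrite big1 ?mul0r // => e _; rewrite mulr0.
Qed.

Lemma suf_setm w (N : nat -> nat -> nat -> nat -> F) o H m v :
  suf w D N o (fixG H v (m v)) m n 0 0 = suf w D N o H m n 0 0.
Proof.
rewrite suf_fixG; apply: suf_ext => i e _ _; rewrite /setm.
by case: eqP => // ->.
Qed.

Lemma represents_ext G1 G2 C1 C2 i :
  (forall a, (a < wA)%N -> bounded (G1 a) (G2 a)) ->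
  (forall a q, (a < wA)%N -> (q < wA)%N -> C1 a q = C2 a q) ->
  represents G1 C1 i -> represents G2 C2 i.
Proof.
move=> EG EC R a m ha bm; rewrite -(suf_bounded _ _ _ oA_lt bm (EG a ha)) R //.
by apply: eq_bigr => q _; rewrite EC.
Qed.

Lemma settled_ext G1 G2 i : (i <= n)%N ->
  (forall a, (a < wA)%N -> bounded (G1 a) (G2 a)) -> settled G1 i -> settled G2 i.
Proof.
move=> hi EG S a j e e' e2 ha hj he he' he2; have hjn := oA_lt (leq_trans hj hi).
by rewrite -!EG //; apply: S.
Qed.

Lemma agreeing_ext G1 G2 :
  (forall a, (a < wA)%N -> bounded (G1 a) (G2 a)) -> agreeing G1 -> agreeing G2.
Proof.
move=> EG E a m ha bm; rewrite -(suf_bounded _ _ _ oA_lt bm (EG a ha)).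
by rewrite -(suf_bounded _ _ _ oB_lt bm (EG a ha)) E.
Qed.

Lemma represents_extend e a m : represents G C k -> (e < D)%N -> (a < wA)%N -> box D m ->
  sufA (fixG (G a) (oA k) e) m n 0 0 =
  \sum_(q < wA) extend e a q * sufA (@idG F) m (n - k.+1) k.+1 q.
Proof.
move=> R he ha bm; rewrite suf_fixG R //; last exact: setm_box.
have -> : (n - k = (n - k.+1).+1)%N by lia.
under eq_bigr => q _ do rewrite /= mulr_sumr.
rewrite exchange_big /=; apply: eq_bigr => q' _; rewrite mulr_suml.
apply: eq_bigr => q _; rewrite mulrA; congr (_ * _ * _).
  rewrite (bigD1 (Ordinal he)) //= /idG /setm eqxx eqxx mulr1 big1 ?addr0 // => e' ne.
  by rewrite eq_sym (_ : (e' == e :> nat) = false) ?mulr0 //; apply/negbTE.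
apply: suf_ext => i' e' hi' _; rewrite /setm; case: eqP => // E.
by have := oA_inj _ _ E; lia.
Qed.

Lemma represents_step : represents G C k -> represents G' C' k.+1.
Proof.
move=> R b m hb bm; case: (slots hb) => [[hC hG]|[e [a [he ha hC hG]]]].
  rewrite (suf_bounded _ _ _ _ bm hG) // suf_zero big1 // => q _.
  by rewrite hC ?mul0r.
rewrite (suf_bounded _ _ _ _ bm hG) // represents_extend //.
by apply: eq_bigr => q _; rewrite hC.
Qed.

Lemma settled_step : settled G k -> settled G' k.+1.
Proof.
move=> S b j e1 e1' e2 hb; rewrite ltnS => hj h1 h1' h2.
have hjn : (j < n)%N by apply: leq_ltn_trans hj kn.
case: (slots hb) => [[_ hG]|[e [a [he ha _ hG]]]]; rewrite !hG ?oA_lt //.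
rewrite /fixG; case: eqP => // ne.
by apply: S => //; rewrite ltn_neqAle hj andbT; apply: contra_not_neq ne => ->.
Qed.

Lemma agreeing_step : agreeing G -> agreeing G'.
Proof.
move=> E b m hb bm; case: (slots hb) => [[_ hG]|[e [a [he ha _ hG]]]].
  by rewrite !(suf_bounded _ _ _ _ bm hG) // !suf_zero.
by rewrite !(suf_bounded _ _ _ _ bm hG) // !suf_fixG E //; apply: setm_box.
Qed.

(** Both sides arise from applying the remaining layers of the first program to the two sides of
    [decomp]. *)
Lemma relation_A e a m : represents G C k -> (e < D)%N -> (a < wA)%N -> box D m ->
  sufA (fixG (G a) (oA k) e) m n 0 0 = \sum_(b < wA) gamma a e b * sufA (G' b) m n 0 0.
Proof.
move=> R he ha bm; rewrite represents_extend //.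
under eq_bigr => q _ do rewrite decomp // mulr_suml.
rewrite exchange_big /=; apply: eq_bigr => b _.
rewrite (represents_step R) // mulr_sumr; apply: eq_bigr => q _.
by rewrite mulrA.
Qed.

Definition relation_B (a e : nat) : Prop := forall m, box D m ->
  sufB (fixG (G a) (oA k) e) m n 0 0 = \sum_(b < wA) gamma a e b * sufB (G' b) m n 0 0.

(** Fixing a variable only moves the requested coefficient, so agreement of [A_a] and [B_a] passes
    to their extensions, and with it the relation for the first program. *)
Lemma relations_B : represents G C k -> agreeing G ->
  forall a e, (a < wA)%N -> (e < D)%N -> relation_B a e.
Proof.
move=> R E a e ha he m bm.
rewrite suf_fixG -E //; last exact: setm_box.
rewrite -suf_fixG relation_A //; apply: eq_bigr => b _.
by rewrite (agreeing_step E).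
Qed.

(** To compare coefficients at [m], fix the variable at the exponent [m] already gives it, which
    changes nothing. Both extensions then expand with the same [gamma] over the next level, where
    the polynomials agree. *)
Lemma agreeing_back : represents G C k ->
  (forall a, (a < wA)%N -> forall e, (e < D)%N -> relation_B a e) ->
  agreeing G' -> agreeing G.
Proof.
move=> R RB E' a m ha bm.
rewrite -(suf_setm wA NA oA (G a) m (oA k)) -(suf_setm wB NB oB (G a) m (oA k)).
rewrite relation_A // RB //; apply: eq_bigr => b _.
by rewrite E'.
Qed.

End Transfer.

(** * The complete program *)

Local Open Scope nat_scope.

(* Arrays 14 and 15 hold the vectors and the substitutions of the slots at the
   current level, arrays 22 and 17 those at the next level, and array 16 the
   matrix [R] of the step between them. *)
Definition check_prep : prog :=
  PSeq (tab 21 [:: (22, 2)]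
    (TSum 100 2 (TCell 14 [:: INum 0; IVar 9; INum 0; IVar 100] *t cell 0 [:: 8; 100; 22; 10])))
  (PSeq (tab 19 [:: (20, 6)]
    (TIf (IVar 20) (IVar 2) (TZero -t TOne)
      (TSum 100 2 (cell 21 [:: 100] *t TCell 16 [:: INum 0; IVar 100; INum 0; IVar 20]))))
  (tab 18 [:: (20, 6); (22, 0); (23, 4); (24, 4)]
    (TIf (IVar 20) (IVar 2)
      (TIf (IVar 22) (IVar 13)
         (TCell 15 [:: INum 0; IVar 9; IVar 22; IVar 10; IVar 24])
         (TCell 15 [:: INum 0; IVar 9; IVar 22; IVar 23; IVar 24]))
      (TCell 17 [:: INum 0; IVar 20; IVar 22; IVar 23; IVar 24])))).

Definition check_all : prog := PFor 9 2 (PFor 10 4 (PSeq check_prep check)).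

Definition load_A : prog :=
  PSeq (tab 2 (pairs2 5 2) (cell 14 [:: 20; 21; 22; 23]))
  (PSeq (tab 4 (slotvars 5 2) (cell 15 [:: 20; 21; 22; 23; 24]))
  (tab 3 [:: (20, 4); (21, 5); (22, 2); (23, 2)] (cell 0 [:: 8; 22; 23; 20]))).

(** The relation tests run [level] themselves and overwrite its arrays, so its results are moved
    away first. The current level stays in place too, since a relation involves both. *)
Definition save_level : prog :=
  PSeq (tab 16 (pairs2 5 2) (cell 7 [:: 20; 21; 22; 23]))
  (PSeq (tab 22 (pairs2 5 2) (cell 8 [:: 20; 21; 22; 23]))
  (tab 17 (slotvars 5 2) (cell 5 [:: 20; 21; 22; 23; 24]))).

Definition next_level : prog :=
  PSeq (tab 14 (pairs2 5 2) (cell 22 [:: 20; 21; 22; 23]))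
  (tab 15 (slotvars 5 2) (cell 17 [:: 20; 21; 22; 23; 24])).

(** The variable being fixed is loaded twice: [level] reads it in variable 12, which the relation
    tests then reuse for the second order, while variable 13 preserves it. *)
Definition main_step : prog :=
  PSeq (PSeq (PLoad 12 0 [:: IVar 8]) (PLoad 13 0 [:: IVar 8]))
  (PSeq load_A (PSeq (level 5 2) (PSeq save_level (PSeq check_all next_level)))).

(** At level 0 slot 0 holds the empty monomial, with the identity table; all other slots represent
    the zero polynomial. *)
Definition main_init : prog :=
  PSeq (PSet 7 (INum 1))
  (PSeq (tab 14 (pairs2 5 2)
     (TIf (IVar 21) (INum 0) (TIf (IVar 23) (INum 0) TOne TZero) TZero))
  (tab 15 (slotvars 5 2)
     (TIf (IVar 21) (INum 0) (TIf (IVar 23) (IVar 24) TOne TZero) TZero))).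

(** Row 0 of the tables is read throughout: when this runs, all variables are fixed and the rows of
    a table coincide. *)
Definition eval_step : prog :=
  PSeq (PLoad 12 1 [:: IVar 11])
    (tabc 21 [:: (22, 3)] (TSum 100 3 (TSum 101 4
       (cell 21 [:: 100] *t cell 1 [:: 11; 100; 22; 101] *t
        TCell 15 [:: INum 0; IVar 9; IVar 12; INum 0; IVar 101])))).

Definition main_final : prog :=
  PFor 9 2
    (PSeq (tab 21 [:: (22, 3)] (TIf (IVar 22) (INum 0) TOne TZero))
    (PSeq (PFor 11 0 eval_step)
    (PIf (TCell 21 [:: INum 0] -t TCell 14 [:: INum 0; IVar 9; INum 0; INum 0])
       (PSet 7 (INum 0))))).

Definition main : prog := PSeq main_init (PSeq (PFor 8 0 main_step) main_final).

Lemma pwf_main : pwf main.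
Proof. by vm_compute. Qed.

Local Open Scope ring_scope.

(** * Correctness of the complete program *)

Section Main.
Variables (F : fieldType) (n D wA wB : nat).
Variables (NA NB : nat -> nat -> nat -> nat -> F) (oA oB : nat -> nat).
Hypothesis oA_lt : forall i, (i < n)%N -> (oA i < n)%N.
Hypothesis oB_lt : forall i, (i < n)%N -> (oB i < n)%N.
Hypothesis oA_inj : forall i j, (i < n)%N -> (j < n)%N -> oA i = oA j -> i = j.
Hypothesis oB_inj : forall i j, (i < n)%N -> (j < n)%N -> oB i = oB j -> i = j.
Hypothesis oA_onto : forall v, (v < n)%N -> exists2 i, (i < n)%N & oA i = v.
Hypotheses (n_gt0 : (0 < n)%N) (D_gt0 : (0 < D)%N) (wA_gt0 : (0 < wA)%N) (wB_gt0 : (0 < wB)%N).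
Local Notation sufA := (suf wA D NA oA).
Local Notation sufB := (suf wB D NB oB).
Implicit Types (s : state F) (m : nat -> nat).

Definition menv s : Prop :=
  [/\ benv n D wA.+1 wB NB oB s, ivar s 2 = wA, ivar s 5 = 1%N,
      forall i q q' e, farr s 0 [:: i; q; q'; e] = NA i q q' e &
      forall i, iarr s 0 [:: i] = oA i].

Lemma menv_low s : menv s ->
  [/\ [/\ ivar s 0 = n, ivar s 2 = wA & ivar s 3 = wB], ivar s 4 = D, ivar s 5 = 1%N &
      ivar s 6 = wA.+1].
Proof. by case=> -[[]]. Qed.

Lemma menv_frame p s : pwf p -> 0%N \notin moda p -> 1%N \notin moda p ->
  menv s -> menv (run p s).
Proof.
move=> wp h0 h1 [b e2 e5 eN eo].
split; [exact: benv_frame|by rewrite run_bound|by rewrite run_bound| |].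
  by move=> *; rewrite run_farr.
by move=> *; rewrite run_iarr.
Qed.

Lemma menv_setv s (x v : nat) : (7 <= x)%N -> menv s -> menv (setv s x v).
Proof.
move=> hx [b e2 e5 eN eo]; split=> //; [exact: benv_setv| |]; by rewrite /= upd_low.
Qed.

Definition Gof (a : nat) s (b : nat) : nat -> nat -> nat -> F :=
  fun v e1 e2 => farr s a [:: 0%N; b; v; e1; e2].
Definition Cof (a : nat) s (b q : nat) : F := farr s a [:: 0%N; b; 0%N; q].

Definition gam s (a e b : nat) (k : nat) : F :=
  \sum_(q < wA) extend wA k NA (Cof 14 s) e a q * farr s 16 [:: 0%N; val q; 0%N; b].

Lemma prep_check_ok s k a e (p := PSeq check_prep check) :
  menv s -> ivar s 8 = k -> ivar s 13 = oA k -> ivar s 9 = a -> ivar s 10 = e ->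
  (a < wA)%N -> (e < D)%N ->
  verdict s (run p s)
    (relation_B n D wA wB k NB oA oB (Gof 15 s) (Gof 17 s) (fun a e b => gam s a e b k) a e).
Proof.
move=> ms h8 h13 h9 h10 ha he; have [[e0 e2 e3] e4 e5 e6] := menv_low ms.
have [_ _ _ eN _] := ms.
rewrite /p /check_prep run_PSeq run_PSeq; move E1 : (run (tab 21 _ _) s) => s1.
rewrite run_PSeq; move E2 : (run (tab 19 _ _) s1) => s2.
move E3 : (run (tab 18 _ _) s2) => s3.
have i1 z : (z < 20)%N -> ivar s1 z = ivar s z by move=> hz; rewrite -E1 tab_low.
have i2 z : (z < 20)%N -> ivar s2 z = ivar s z by move=> hz; rewrite -E2 tab_low ?i1.
have i3 z : (z < 20)%N -> ivar s3 z = ivar s z by move=> hz; rewrite -E3 tab_low ?i2.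
have g1 (z : nat) : z != 21%N -> farr s1 z = farr s z by move=> h; rewrite -E1 tab_farr.
have g2 (z : nat) : z != 19%N -> farr s2 z = farr s1 z by move=> h; rewrite -E2 tab_farr.
have g3 (z : nat) : z != 18%N -> farr s3 z = farr s2 z by move=> h; rewrite -E3 tab_farr.
have m3 : menv s3 by rewrite -E3 -E2 -E1; do 3 (apply: menv_frame => //).
have f1 q : (q < wA)%N -> farr s1 21 [:: q] = extend wA k NA (Cof 14 s) e a q.
  move=> hq; rewrite -E1 run_tab // [inbox _ _ _]/= e2 hq [andb _ _]/=.
  rewrite (@teval_sum1 _ _ _ _ wA); last by rewrite /= !upd_low.
  by apply: eq_bigr => q' _; rewrite /= /upd_var /= h9 h8 h10 eN.
have f2 l : (l < wA.+1)%N -> farr s2 19 [:: l] = if l == wA then -1 else gam s a e l k.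
  move=> hl; rewrite -E2 run_tab // [inbox _ _ _]/= i1 // e6 hl [andb _ _]/=.
  rewrite [LHS]/= !(@upd_low _ 20 l 2) // i1 // e2 /upd_var /=.
  case: eqP => [_|_]; first by rewrite sub0r.
  by apply: eq_bigr => q _; rewrite /= f1 // g1.
have f3 l v e1 e2' : (l < wA.+1)%N -> (v < n)%N -> (e1 < D)%N -> (e2' < D)%N ->
    farr s3 18 [:: l; v; e1; e2'] =
    if l == wA then fixG (Gof 15 s a) (oA k) e v e1 e2' else Gof 17 s l v e1 e2'.
  move=> hl hv h1 h2; rewrite -E3 run_tab // [inbox _ _ _]/= !i2 // e6 e0 e4 hl hv h1 h2.
  rewrite /= /upd_var /= !i2 // e2 h13 h9 h10 !g2 // !g1 // /fixG /Gof.
have b3 : benv n D wA.+1 wB NB oB s3 by case: m3.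
have := @check_ok F n D wA.+1 wB NB oB oB_inj D_gt0 isT wB_gt0 s3 b3.
have -> : verdict s3 (run check s3) = verdict s (run check s3).
  by rewrite /verdict i3.
apply: verdict_iff; rewrite /relation_B.
(* The last block, of index [wA], is the extension itself with coefficient -1; the others are the
   slots of the next level. *)
have S m : box D m -> \sum_(l < wA.+1) farr s3 19 [:: val l] * sufB (G2 s3 l) m n 0 0 =
    \sum_(b < wA) gam s a e b k * sufB (Gof 17 s b) m n 0 0 -
    sufB (fixG (Gof 15 s a) (oA k) e) m n 0 0.
  move=> bm; rewrite big_ord_recr /= g3 // f2 // eqxx mulN1r; congr (_ - _).
    apply: eq_bigr => b _; have hb := leqW (ltn_ord b); rewrite f2 // ltn_eqF //; congr (_ * _).
    apply: (suf_bounded _ _ _ oB_lt bm) => v e1 e2' hv h1 h2.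
    by rewrite /G2 f3 // ltn_eqF.
  apply: (suf_bounded _ _ _ oB_lt bm) => v e1 e2' hv h1 h2.
  by rewrite /G2 f3 // eqxx.
split=> H m bm; have := H m bm.
  by rewrite S // => /eqP; rewrite subr_eq0 => /eqP ->.
by rewrite S // => ->; rewrite subrr.
Qed.

Definition all_relations s k : Prop :=
  forall a, (a < wA)%N -> forall e, (e < D)%N ->
    relation_B n D wA wB k NB oA oB (Gof 15 s) (Gof 17 s) (fun a e b => gam s a e b k) a e.

Lemma check_all_ok s k (s' := run check_all s) :
  menv s -> ivar s 8 = k -> ivar s 13 = oA k -> verdict s s' (all_relations s k).
Proof.
move=> ms h8 h13; have [[e0 e2 e3] e4 e5 e6] := menv_low ms.
pose K s1 := [/\ menv s1, ivar s1 8 = k, ivar s1 13 = oA k &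
  forall a, a \in [:: 14; 15; 16; 17]%N -> farr s1 a = farr s a].
have Kset s1 (x v : nat) : (7 <= x)%N -> x != 8%N -> x != 13%N -> K s1 -> K (setv s1 x v).
  by move=> hx x8 x13 [k1 k2 k3 k4]; split=> //; [exact: menv_setv| |];
    rewrite setv_other // eq_sym.
have K9 s1 v : K s1 -> K (setv s1 9 v) by apply: Kset.
have K10 s1 v : K s1 -> K (setv s1 10 v) by apply: Kset.
have K0 : K s by [].
have E s1 a e : K s1 -> relation_B n D wA wB k NB oA oB (Gof 15 s1) (Gof 17 s1)
      (fun a e b => gam s1 a e b k) a e <->
    relation_B n D wA wB k NB oA oB (Gof 15 s) (Gof 17 s) (fun a e b => gam s a e b k) a e.
  case=> _ _ _ k4; suff [-> ->] : Gof 15 s1 = Gof 15 s /\ Gof 17 s1 = Gof 17 s.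
    by rewrite /relation_B /gam /Cof !k4.
  by rewrite /Gof !k4.
rewrite /s' /check_all; set q := PFor 10 4 _.
have := @verdict_for _ K 9%N 2%N q s (fun a => forall e, (e < D)%N ->
    relation_B n D wA wB k NB oA oB (Gof 15 s) (Gof 17 s) (fun a e b => gam s a e b k) a e)
  isT K9 K0.
rewrite e2 => H; apply: (proj2 (H _)) => {H}a s1 ha K1 h9.
have e41 : ivar s1 4 = D by case: K1 => /menv_low[].
have [] := @verdict_for _ (fun s2 => K s2 /\ ivar s2 9 = a) 10%N 4%N (PSeq check_prep check) s1
  (fun e => relation_B n D wA wB k NB oA oB (Gof 15 s) (Gof 17 s) (fun a e b => gam s a e b k) a e)
  isT.
- by move=> s2 v [k1 k2]; split; [exact: K10|rewrite setv_other].
- by [].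
- move=> e s2 he [K2 h92] h10; rewrite e41 in he.
  have [m2 h82 h132 k4] := K2.
  split.
    split; last by rewrite run_ivar.
    split; [exact: menv_frame|by rewrite run_ivar|by rewrite run_ivar|].
    move=> b hb; rewrite -k4 // run_farr //.
    by move: hb; rewrite !inE => /or4P[] /eqP ->.
  apply: verdict_iff (E s2 a e K2) _.
  exact: prep_check_ok.
by case=> K2 _; rewrite e41.
Qed.

Lemma ord1_nat (x : 'I_1) : val x = 0%N.
Proof. by rewrite (ord1 x). Qed.

Lemma sum_pair1 w (f : 'I_1 * 'I_w -> F) : \sum_x f x = \sum_(q < w) f (ord0, q).
Proof.
rewrite (eq_bigr (fun x => f (x.1, x.2))); last by case.
by rewrite -(pair_bigA _ (fun a b => f (a, b))) /= big_ord1.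
Qed.

(** The tested relations refer to a state inside the step, whose arrays are later overwritten; hence
    they appear as an existential [RB] with its two uses. *)
Lemma main_step_ok s k (s' := run main_step s) :
  menv s -> ivar s 8 = k -> (k < n)%N ->
  represents n D wA NA oA (Gof 15 s) (Cof 14 s) k -> settled D wA oA (Gof 15 s) k ->
  [/\ menv s', represents n D wA NA oA (Gof 15 s') (Cof 14 s') k.+1,
      settled D wA oA (Gof 15 s') k.+1,
      agreeing n D wA wB NA NB oA oB (Gof 15 s) -> agreeing n D wA wB NA NB oA oB (Gof 15 s') &
      exists RB : Prop, [/\ verdict s s' RB,
        agreeing n D wA wB NA NB oA oB (Gof 15 s) -> RB &
        RB -> agreeing n D wA wB NA NB oA oB (Gof 15 s') ->
          agreeing n D wA wB NA NB oA oB (Gof 15 s)]].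
Proof.
move=> ms h8 hk R S; have [[e0 e2 e3] e4 e5 e6] := menv_low ms.
have [_ _ _ eN eo] := ms.
have ms' : menv s' by apply: menv_frame.
rewrite /s' /main_step in ms' *; move: ms'.
rewrite run_PSeq; move E1 : (run (PSeq (PLoad _ _ _) _) s) => s1.
rewrite run_PSeq; move E2 : (run load_A s1) => s2; rewrite /load_A !run_PSeq in E2.
rewrite run_PSeq; move E3 : (run (level 5 2) s2) => s3.
rewrite run_PSeq; move E4 : (run save_level s3) => s4; rewrite /save_level !run_PSeq in E4.
rewrite run_PSeq; move E5 : (run check_all s4) => s5.
move E6 : (run next_level s5) => s6 ms6; rewrite /next_level !run_PSeq in E6.
move: E2; move E21 : (run (tab 2 _ _) s1) => s21.
move E22 : (run (tab 4 _ _) s21) => s22 E2.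
move: E4; move E41 : (run (tab 16 _ _) s3) => s41.
move E42 : (run (tab 22 _ _) s41) => s42 E4.
move: E6; move E61 : (run (tab 14 _ _) s5) => s61 E6.
have f1 : farr s1 = farr s by rewrite -E1.
have i1 z : (z < 12)%N -> ivar s1 z = ivar s z.
  by move=> hz; rewrite -E1 run_ivar // !inE negb_or; apply/andP; split; apply: contraTneq hz => ->.
have i1' z : (z < 7)%N -> ivar s1 z = ivar s z by move=> hz; apply: i1; apply: leq_trans hz _.
have v12 : ivar s1 12 = oA k by rewrite -E1 /= /upd_var /= h8 eo.
have v13 : ivar s1 13 = oA k by rewrite -E1 /= /upd_var /= h8 eo.
have low p t z : pwf p -> (z < 7)%N -> ivar (run p t) z = ivar t z by move=> *; apply: run_bound.
have i21 z : (z < 20)%N -> ivar s21 z = ivar s1 z by move=> hz; rewrite -E21 tab_low.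
have i22 z : (z < 20)%N -> ivar s22 z = ivar s1 z by move=> hz; rewrite -E22 tab_low ?i21.
have i2' z : (z < 20)%N -> ivar s2 z = ivar s1 z by move=> hz; rewrite -E2 tab_low ?i22.
have i2 z : (z < 7)%N -> ivar s2 z = ivar s z by move=> hz; rewrite i2' ?i1' // (ltn_trans hz).
have i3 z : (z < 7)%N -> ivar s3 z = ivar s z by move=> hz; rewrite -E3 low // i2.
have i41 z : (z < 20)%N -> ivar s41 z = ivar s3 z by move=> hz; rewrite -E41 tab_low.
have i42 z : (z < 20)%N -> ivar s42 z = ivar s3 z by move=> hz; rewrite -E42 tab_low ?i41.
have i4' z : (z < 20)%N -> ivar s4 z = ivar s3 z by move=> hz; rewrite -E4 tab_low ?i42.
have i4 z : (z < 7)%N -> ivar s4 z = ivar s z by move=> hz; rewrite i4' ?i3 // (ltn_trans hz).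
have i5 z : (z < 7)%N -> ivar s5 z = ivar s z by move=> hz; rewrite -E5 low // i4.
have i61 z : (z < 20)%N -> ivar s61 z = ivar s5 z by move=> hz; rewrite -E61 tab_low.
have g21 (a : nat) : a != 2%N -> farr s21 a = farr s a by move=> h; rewrite -E21 tab_farr ?f1.
have g22 (a : nat) : a != 4%N -> farr s22 a = farr s21 a by move=> h; rewrite -E22 tab_farr.
have g2 (a : nat) : a != 3%N -> farr s2 a = farr s22 a by move=> h; rewrite -E2 tab_farr.
have g3 a : a \notin moda (level 5 2) -> farr s3 a = farr s2 a.
  by move=> h; rewrite -E3 run_farr.
have g41 (a : nat) : a != 16%N -> farr s41 a = farr s3 a by move=> h; rewrite -E41 tab_farr.
have g42 (a : nat) : a != 22%N -> farr s42 a = farr s41 a by move=> h; rewrite -E42 tab_farr.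
have g4 (a : nat) : a != 17%N -> farr s4 a = farr s42 a by move=> h; rewrite -E4 tab_farr.
have g5 a : a \notin moda check_all -> farr s5 a = farr s4 a.
  by move=> h; rewrite -E5 run_farr.
have g61 (a : nat) : a != 14%N -> farr s61 a = farr s5 a by move=> h; rewrite -E61 tab_farr.
have g6 (a : nat) : a != 15%N -> farr s6 a = farr s61 a by move=> h; rewrite -E6 tab_farr.
have m4 : menv s4.
  by rewrite -E4 -E42 -E41 -E3 -E2 -E22 -E21 -E1; do 8 (apply: menv_frame => //).
have f2 b q : (b < wA)%N -> (q < wA)%N -> farr s2 2 [:: 0; b; 0; q]%N = Cof 14 s b q.
  move=> hb hq; rewrite g2 // g22 // -E21 run_tab // [inbox _ _ _]/= !i1' // e5 e2 hb hq.
  by rewrite /= /upd_var /= f1.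
have fG2 b v e1 e2' : (b < wA)%N -> (v < n)%N -> (e1 < D)%N -> (e2' < D)%N ->
    farr s2 4 [:: 0; b; v; e1; e2']%N = Gof 15 s b v e1 e2'.
  move=> hb hv h1 h2; rewrite g2 // -E22 run_tab // [inbox _ _ _]/= !i21 // !i1' //.
  by rewrite e5 e2 e0 e4 hb hv h1 h2 /= /upd_var /= g21.
have fT e q q' : (e < D)%N -> (q < wA)%N -> (q' < wA)%N ->
    farr s2 3 [:: e; 0; q; q']%N = NA k q q' e.
  move=> he hq hq'; rewrite -E2 run_tab // [inbox _ _ _]/= !i22 // !i1' //.
  by rewrite e5 e2 e4 he hq hq' /= /upd_var /= g22 // g21 // i22 // i1 // h8 eN.
have [hA hB] := @level_spec F 1 wA n D 5 2 s2 isT isT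
  (etrans (i2 5 isT) e5) (etrans (i2 2 isT) e2)
  (etrans (i2 0 isT) e0) (etrans (i2 4 isT) e4).
rewrite E3 in hA hB.
have v2 : ivar s2 12 = oA k by rewrite i2'.
have sv e b q : (e < D)%N -> (b < wA)%N -> (q < wA)%N -> forall x y : 'I_1 * 'I_wA,
    val x.2 = b -> val y.2 = q -> stepv s2 e x y = extend wA k NA (Cof 14 s) e b q.
  move=> he hb hq x y xb yq; rewrite /stepv !ord1_nat xb yq.
  by apply: eq_bigr => q' _; have hq' : (q' < wA)%N := ltn_ord q'; rewrite f2 // fT.
have f16 b q : (b < wA)%N -> (q < wA)%N ->
    farr s4 16 [:: 0; b; 0; q]%N = farr s3 7 [:: 0; b; 0; q]%N.
  move=> hb hq; rewrite g4 // g42 // -E41 run_tab // [inbox _ _ _]/= !i3 // e5 e2 hb hq.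
  by rewrite /= /upd_var.
have f22 b q : (b < wA)%N -> (q < wA)%N ->
    farr s4 22 [:: 0; b; 0; q]%N = farr s3 8 [:: 0; b; 0; q]%N.
  move=> hb hq; rewrite g4 // -E42 run_tab // [inbox _ _ _]/= !i41 // !i3 // e5 e2 hb hq.
  by rewrite /= /upd_var /= g41.
have fG4 b v e1 e2' : (b < wA)%N -> (v < n)%N -> (e1 < D)%N -> (e2' < D)%N ->
    Gof 17 s4 b v e1 e2' = farr s3 5 [:: 0; b; v; e1; e2']%N.
  move=> hb hv h1 h2; rewrite /Gof -E4 run_tab // [inbox _ _ _]/= !i42 // !i3 //.
  by rewrite e5 e2 e0 e4 hb hv h1 h2 /= /upd_var /= g42 // g41.
have slots : forall b, (b < wA)%N ->
    ((forall q, (q < wA)%N -> Cof 22 s4 b q = 0) /\ bounded n D (Gof 17 s4 b) (fun _ _ _ => 0)) \/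
    exists e a, [/\ (e < D)%N, (a < wA)%N,
      forall q, (q < wA)%N -> Cof 22 s4 b q = extend wA k NA (Cof 14 s) e a q &
      bounded n D (Gof 17 s4 b) (fixG (Gof 15 s a) (oA k) e)].
  move=> b hb; case: (hA (ord0, Ordinal hb)) => [[h1 h2]|[e [x [he h1 h2]]]]; [left|right].
    split; first by move=> q hq; rewrite /Cof f22 //; apply: (h1 (ord0, Ordinal hq)).
    by move=> v e1 e2' hv he1 he2; rewrite fG4 //; apply: h2.
  have hx : (val x.2 < wA)%N := ltn_ord x.2.
  exists e, (val x.2); split=> //.
    move=> q hq; rewrite /Cof f22 // -(sv _ _ _ he hx hq x (ord0, Ordinal hq)) //.
    exact: (h1 (ord0, Ordinal hq)).
  move=> v e1 e2' hv he1 he2; rewrite fG4 // h2 // v2 /fixG !ord1_nat.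
  by case: eqP => // E; rewrite fG2.
have decomp e a q : (e < D)%N -> (a < wA)%N -> (q < wA)%N ->
    extend wA k NA (Cof 14 s) e a q = \sum_(b < wA) gam s4 a e b k * Cof 22 s4 b q.
  move=> he ha hq.
  rewrite -(sv _ _ _ he ha hq (ord0, Ordinal ha) (ord0, Ordinal hq)) // hB // sum_pair1.
  apply: eq_bigr => b _; have hb : (b < wA)%N := ltn_ord b; rewrite /Cof f22 //; congr (_ * _).
  rewrite sum_pair1 /gam; apply: eq_bigr => q' _.
  have hq' : (q' < wA)%N := ltn_ord q'; rewrite f16 //.
  rewrite (sv e a q') //; congr (_ * _); apply: eq_bigr => t _.
  by rewrite /Cof g4 // g42 // g41 // g3 // g2 // g22 // g21.
have h84 : ivar s4 8 = k by rewrite i4' // -E3 run_ivar // i2' // i1.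
have h134 : ivar s4 13 = oA k by rewrite i4' // -E3 run_ivar // i2'.
have G154 : Gof 15 s4 = Gof 15 s by rewrite /Gof g4 // g42 // g41 // g3 // g2 // g22 // g21.
have V := check_all_ok m4 h84 h134; rewrite E5 in V.
have fG6 b : (b < wA)%N -> bounded n D (Gof 17 s4 b) (Gof 15 s6 b).
  move=> hb v e1 e2' hv he1 he2; rewrite /Gof -E6 run_tab // [inbox _ _ _]/= !i61 // !i5 //.
  by rewrite e5 e2 e0 e4 hb hv he1 he2 /= /upd_var /= g61 // g5.
have f6 b q : (b < wA)%N -> (q < wA)%N -> Cof 22 s4 b q = Cof 14 s6 b q.
  move=> hb hq; rewrite /Cof g6 // -E61 run_tab // [inbox _ _ _]/= !i5 // e5 e2 hb hq.
  by rewrite /= /upd_var /= g5.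
have R' := represents_step oA_lt oA_inj hk slots R.
split=> //.
- exact: represents_ext fG6 f6 R'.
- by apply: (settled_ext oA_lt hk fG6); apply: (settled_step oA_lt hk slots).
- by move=> E; apply: (agreeing_ext oA_lt oB_lt fG6); apply: (agreeing_step oA_lt oB_lt hk slots).
exists (all_relations s4 k); split.
- have v4 : ivar s4 7 = ivar s 7 by rewrite i4' // -E3 run_ivar // i2' // i1.
  have v6 : ivar s6 7 = ivar s5 7 by rewrite -E6 tab_low // i61.
  by move: V; rewrite /verdict v4 v6.
- move=> E a ha e he; rewrite G154.
  exact: (relations_B oA_lt oB_lt oA_inj hk slots decomp R E).
move=> RB E; rewrite /all_relations G154 in RB.
apply: (agreeing_back oA_lt oA_inj hk slots decomp R RB).
have fG6' b : (b < wA)%N -> bounded n D (Gof 15 s6 b) (Gof 17 s4 b).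
  by move=> hb v e1 e2' *; rewrite fG6.
exact: (agreeing_ext oA_lt oB_lt fG6' E).
Qed.

Definition same_poly : Prop := forall m, box D m ->
  sufA (@idG F) m n 0 0 = sufB (@idG F) m n 0 0.

Lemma main_init_ok s (s' := run main_init s) : menv s ->
  [/\ menv s', ivar s' 7 = 1%N, represents n D wA NA oA (Gof 15 s') (Cof 14 s') 0 &
      agreeing n D wA wB NA NB oA oB (Gof 15 s') <-> same_poly].
Proof.
move=> ms; have [[e0 e2 e3] e4 e5 e6] := menv_low ms.
have ms' : menv s' by apply: menv_frame.
rewrite /s' /main_init in ms' *; move: ms'.
rewrite run_PSeq; move E1 : (run (PSet _ _) s) => s1.
rewrite run_PSeq; move E2 : (run (tab 14 _ _) s1) => s2.
move E3 : (run (tab 15 _ _) s2) => s3 ms3.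
have i1 z : (z < 7)%N -> ivar s1 z = ivar s z by move=> hz; rewrite -E1 /= upd_low.
have i2 z : (z < 20)%N -> ivar s2 z = ivar s1 z by move=> hz; rewrite -E2 tab_low.
have C3 a q : (a < wA)%N -> (q < wA)%N -> Cof 14 s3 a q = ((a == 0%N) && (q == 0%N))%:R.
  move=> ha hq; rewrite /Cof -E3 tab_farr // -E2 run_tab // [inbox _ _ _]/= !i1 //.
  rewrite e5 e2 ha hq /= /upd_var /=; by case: eqP => //= _; case: eqP.
have G3 a : (a < wA)%N -> bounded n D (if a == 0%N then @idG F else (fun _ _ _ => 0)) (Gof 15 s3 a).
  move=> ha v e1 e2' hv he1 he2; rewrite /Gof -E3 run_tab // [inbox _ _ _]/= !i2 // !i1 //.
  rewrite e5 e2 e0 e4 ha hv he1 he2 /= /upd_var /= /idG; case: eqP => //= _.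
  by case: eqP.
split=> //.
- by rewrite -E3 tab_low // i2 // -E1.
- move=> a m ha bm; rewrite -(suf_bounded _ _ _ oA_lt bm (G3 a ha)) subn0.
  case: eqP => [a0|a0].
    rewrite (bigD1 (Ordinal wA_gt0)) //= C3 // a0 mul1r big1 ?addr0 // => q.
    have hq : (q < wA)%N := ltn_ord q.
    by rewrite -val_eqE /= => /negbTE h; rewrite C3 // ?a0 // h mul0r.
  rewrite (suf_zero _ n_gt0) big1 // => q _.
  have hq : (q < wA)%N := ltn_ord q.
  by rewrite C3 //; case: eqP a0 => //= _ _; rewrite mul0r.
split=> [E m bm|E a m ha bm].
  have := E 0%N m wA_gt0 bm.
  rewrite -(suf_bounded _ _ _ oA_lt bm (G3 _ wA_gt0)).
  by rewrite -(suf_bounded _ _ _ oB_lt bm (G3 _ wA_gt0)).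
rewrite -(suf_bounded _ _ _ oA_lt bm (G3 a ha)) -(suf_bounded _ _ _ oB_lt bm (G3 a ha)).
by case: eqP => _; [exact: E|rewrite !(suf_zero _ n_gt0)].
Qed.

(** The prefix vector in array 21 paired with the remaining layers: this number does not change
    along the evaluation of the restricted second program. *)
Definition vdot s a i : F :=
  \sum_(q < wB) farr s 21 [:: val q] * sufB (Gof 15 s a) (fun=> 0%N) (n - i) i q.

Lemma eval_step_ok s a i (s' := run eval_step s) :
  menv s -> ivar s 9 = a -> ivar s 11 = i -> (i < n)%N -> vdot s' a i.+1 = vdot s a i.
Proof.
move=> ms h9 h11 hi; have [[e0 e2 e3] e4 e5 e6] := menv_low ms.
have [[_ eN eo] _ _ _ _] := ms.
rewrite /s' /eval_step run_PSeq; move E1 : (run (PLoad _ _ _) s) => s1.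
move E2 : (run (tabc 21 _ _) s1) => s2.
have i1 z : z != 12%N -> ivar s1 z = ivar s z by move=> h; rewrite -E1 setv_other.
have v1 : ivar s1 12 = oB i by rewrite -E1 setv_same /= h11 eo.
have f1 : farr s1 = farr s by rewrite -E1.
have G2 : Gof 15 s2 a = Gof 15 s a by rewrite /Gof -E2 tabc_farr // f1.
have f2 q' : (q' < wB)%N -> farr s2 21 [:: q'] =
    \sum_(q < wB) farr s 21 [:: val q] * \sum_(e < D) NB i q q' e * Gof 15 s a (oB i) 0%N e.
  move=> hq'; rewrite -E2 run_tabc // [inbox _ _ _]/= i1 // e3 hq' [andb _ _]/=.
  rewrite (@teval_sum2 _ _ _ _ _ wB D) //; try by rewrite /= upd_low // i1.
  rewrite -(pair_bigA _ (fun (q : 'I_wB) (e : 'I_D) => teval (setv (setv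
    (setvs s1 [:: (22, 3)%N] [:: q']) 100 q) 101 e) _)) /=.
  apply: eq_bigr => q _; rewrite mulr_sumr; apply: eq_bigr => e _.
  by rewrite /= /upd_var /= (i1 11) // (i1 9) // h11 h9 v1 f1 eN mulrA.
rewrite /vdot G2 (_ : (n - i = (n - i.+1).+1)%N); last by lia.
under [RHS]eq_bigr => q _ do rewrite /= mulr_sumr.
rewrite [RHS]exchange_big /=; apply: eq_bigr => q' _.
have hq' : (q' < wB)%N := ltn_ord q'.
rewrite f2 // mulr_suml; apply: eq_bigr => q _; by rewrite mulrA.
Qed.

Lemma main_final_ok s (s' := run main_final s) : menv s ->
  represents n D wA NA oA (Gof 15 s) (Cof 14 s) n -> settled D wA oA (Gof 15 s) n ->
  verdict s s' (agreeing n D wA wB NA NB oA oB (Gof 15 s)).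
Proof.
move=> ms R S; have [[e0 e2 e3] e4 e5 e6] := menv_low ms.
pose value a := sufB (Gof 15 s a) (fun=> 0%N) n 0 0.
have RA a m : (a < wA)%N -> box D m -> sufA (Gof 15 s a) m n 0 0 = Cof 14 s a 0.
  move=> ha bm; rewrite R // subnn (bigD1 (Ordinal wA_gt0)) //= mulr1 big1 ?addr0 // => q.
  by rewrite -val_eqE /= => /negbTE ->; rewrite mulr0.
(* [settled] speaks of positions in the first order; [oA_onto] carries it to the variables met in
   the second. *)
have RB a m : (a < wA)%N -> box D m -> sufB (Gof 15 s a) m n 0 0 = value a.
  move=> ha bm; apply: suf_ext => i e hi he.
  by have [j hj <-] := oA_onto (oB_lt (hi : (i < n)%N)); apply: S.
have AE : (forall a, (a < wA)%N -> value a = Cof 14 s a 0) <->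
    agreeing n D wA wB NA NB oA oB (Gof 15 s).
  split=> [H a m ha bm|H a ha]; first by rewrite RA // RB // H.
  by rewrite -(RA a (fun=> 0%N)) // H.
apply: verdict_iff AE _.
pose K s1 := menv s1 /\ forall a, a \in [:: 14; 15]%N -> farr s1 a = farr s a.
have Kset s1 (x v : nat) : (7 <= x)%N -> K s1 -> K (setv s1 x v).
  by move=> hx [k1 k2]; split=> //; exact: menv_setv.
have K9 s1 v : K s1 -> K (setv s1 9 v) by apply: Kset.
have K0 : K s by [].
rewrite /s' /main_final; set q := PSeq _ _.
have := @verdict_for _ K 9%N 2%N q s (fun a => value a = Cof 14 s a 0) isT K9 K0.
rewrite e2 => H; apply: (proj2 (H _)) => {H} a s1 ha [m1 k1] h9.
have Kq : K (run q s1).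
  split; first exact: menv_frame.
  by move=> b hb; rewrite -k1 // run_farr //; move: hb; rewrite !inE => /orP[] /eqP ->.
split=> //; move: Kq; rewrite /q run_PSeq; move E1 : (run (tab 21 _ _) s1) => s2.
rewrite run_PSeq; move E2 : (run (PFor 11 0 eval_step) s2) => s3 _.
have m2 : menv s2 by rewrite -E1; apply: menv_frame.
have e02 : ivar s2 0 = n by case: (menv_low m2) => -[].
have G2 : Gof 15 s2 a = Gof 15 s a by rewrite /Gof -E1 tab_farr // k1.
have V2 : vdot s2 a 0 = value a.
  have f2 r : (r < wB)%N -> farr s2 21 [:: r] = (r == 0%N)%:R.
    move=> hr; have [[_ _ e31] _ _ _] := menv_low m1.
    rewrite -E1 run_tab // [inbox _ _ _]/= e31 hr /= /upd_var /=.
    by case: eqP.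
  rewrite /vdot G2 subn0 (bigD1 (Ordinal wB_gt0)) //= f2 // mul1r big1 ?addr0 // => r.
  have hr : (r < wB)%N := ltn_ord r.
  by rewrite -val_eqE /= => /negbTE h; rewrite f2 // h mul0r.
have [m3 h93 G3 V3 v73] : [/\ menv s3, ivar s3 9 = a, (farr s3 14 = farr s 14),
    vdot s3 a n = value a & ivar s3 7 = ivar s1 7].
  rewrite -E2 -{1}e02; apply: (forP (Inv := fun i s4 => [/\ menv s4, ivar s4 9 = a,
    (farr s4 14 = farr s 14), vdot s4 a i = value a & ivar s4 7 = ivar s1 7])).
  - by split=> //; rewrite -E1 ?tab_low ?tab_farr // k1.
  - move=> i s4 hi [m4 h4 g4 V4 v4]; rewrite e02 in hi.
    have m4' : menv (setv s4 11 i) by apply: menv_setv.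
    split; [exact: menv_frame|by rewrite run_ivar ?setv_other|by rewrite run_farr| |].
      by rewrite (eval_step_ok m4' _ (setv_same _ _ _)) ?setv_other.
    by rewrite run_ivar ?setv_other.
  - by move=> s4 v [m4 h4 g4 V4 v4]; split=> //; exact: menv_setv.
rewrite run_PIf.
have -> : teval s3 (TCell 21 [:: INum 0] -t TCell 14 [:: INum 0; IVar 9; INum 0; INum 0]) =
    value a - Cof 14 s a 0.
  rewrite /= h93 /Cof G3 -V3 /vdot subnn (bigD1 (Ordinal wB_gt0)) //= mulr1.
  by rewrite big1 ?addr0 // => r; rewrite -val_eqE /= => /negbTE ->; rewrite mulr0.
rewrite subr_eq0; case: eqP => Z; first by left.
by right; split; first exact: setv_same.
Qed.

Lemma main_ok s (s' := run main s) : menv s ->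
  (ivar s' 7 = 1%N /\ same_poly) \/ (ivar s' 7 = 0%N /\ ~ same_poly).
Proof.
move=> ms; rewrite /s' /main.
rewrite run_PSeq; have [] := main_init_ok ms; move: (run main_init s) => s1 m1 h1 R1 A1.
rewrite run_PSeq; move E2 : (run (PFor 8 0 main_step) s1) => s2.
have e01 : ivar s1 0 = n by case: (menv_low m1) => -[].
(* While the flag is 1, agreement at the current level is equivalent to the original question. A
   failed relation refutes equality for good, and the flag stays 0. *)
have [m2 R2 S2 H2] : [/\ menv s2, represents n D wA NA oA (Gof 15 s2) (Cof 14 s2) n,
    settled D wA oA (Gof 15 s2) n &
    (ivar s2 7 = 1%N /\ (agreeing n D wA wB NA NB oA oB (Gof 15 s2) <-> same_poly)) \/
    (ivar s2 7 = 0%N /\ ~ same_poly)].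
  rewrite -E2 -[X in represents _ _ _ _ _ _ _ X]e01 -[X in settled _ _ _ _ X]e01.
  apply: (forP (Inv := fun k s3 => [/\ menv s3,
    represents n D wA NA oA (Gof 15 s3) (Cof 14 s3) k, settled D wA oA (Gof 15 s3) k &
    (ivar s3 7 = 1%N /\ (agreeing n D wA wB NA NB oA oB (Gof 15 s3) <-> same_poly)) \/
    (ivar s3 7 = 0%N /\ ~ same_poly)])).
  - by split=> //; left.
  - move=> k s3 hk [m3 R3 S3 H3]; rewrite e01 in hk.
    have m3' : menv (setv s3 8 k) by apply: menv_setv.
    have [m4 R4 S4 A4 [RB [V B1 B2]]] :=
      @main_step_ok (setv s3 8 k) k m3' (setv_same _ _ _) hk R3 S3.
    split=> //; move: V; rewrite /verdict setv_other //.
    case: H3 => [[h3 E3]|[h3 E3]] [[-> hRB]|[-> hRB]]; rewrite ?h3.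
    + left; split=> //; split=> [E|E]; first by apply/E3; apply: B2 hRB E.
      by apply: A4; apply/E3.
    + by right; split=> // E; apply: hRB; apply: B1; apply/E3.
    + by right.
    + by right.
  - by move=> s3 v [m3 R3 S3 H3]; split=> //; exact: menv_setv.
have := main_final_ok m2 R2 S2; rewrite /verdict.
case: H2 => [[h2 E2']|[h2 E2']] [[-> Q]|[-> Q]]; rewrite ?h2.
- by left; split=> //; apply/E2'.
- by right; split=> // E; apply: Q; apply/E2'.
- by right.
- by right.
Qed.

End Main.

(** * The machine program and its running time *)

(** The derived bounds are the number [d + 1] of exponents, the one block of the first program and
    the [wA + 1] blocks of a relation. They are set by raw commands because variables below 7 are
    read-only in the loop language. *)
Definition preamble : cmd :=
  Seq (ISet 4 (IAdd (IVar 1) (INum 1)))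
    (Seq (ISet 5 (INum 1)) (ISet 6 (IAdd (IVar 2) (INum 1)))).

Definition decide : cmd := Seq preamble (Seq (cprog main) (ISet 0 (IVar 7))).

Theorem theorem3p1 :
  exists (P : cmd) (c : nat),
    forall (F : fieldType) (n d w wA wB : nat)
      (A : roabp F n wA) (B : roabp F n wB),
      (0 < n)%N ->
      (0 < wA <= w)%N ->
      (0 < wB <= w)%N ->
      individual_degree_le d (roabp_poly A) ->
      individual_degree_le d (roabp_poly B) ->
      decides_within P (input d A B) (roabp_poly A == roabp_poly B)
        (c * (n + d + w).+1 ^ c)%N.
Proof.
(* The 20 covers the 10 steps of the preamble and the 2 of the final copy of the answer. *)
have [c Hc] : poly_bounded (fun M => pcost main M + 20)%N.
  exact: (poly_boundedD (poly_bounded_pcost main) (poly_bounded_const 20)).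
(* The cost is bounded in powers of [M + 1], one more than the base in the claim; [M + 1 <= 2 M]
   moves the factor [2 ^ c] into the constant. *)
exists decide, (c * 2 ^ c)%N => F n d w wA wB A B hn /andP[hA hAw] /andP[hB hBw] dA dB.
set M := (n + d + w).+1.
set s0 := setv (setv (setv (input d A B) 4 (d + 1)) 5 1) 6 (wA + 1).
have E0 : exec preamble (input d A B) 10 s0.
  by apply: (@ExecSeq _ _ _ _ 4); [exact: ExecISet|apply: (@ExecSeq _ _ _ _ 2); exact: ExecISet].
have S0 : sim s0 s0 by split.
have HM x : (x < 7)%N -> (ivar s0 x <= M)%N.
  by do 7 (case: x => [|x]; first by move=> _; rewrite /M /s0 /= /upd_var /=; lia).
have [T [s1 [E1 C1 [V1 _ _]]]] := cprogP pwf_main S0 HM.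
have m0 : menv n d.+1 wA wB (roabp_coef A) (roabp_coef B) (roabp_order A) (roabp_order B) s0.
  by split=> //; first split=> //; rewrite /= ?addn1.
have onto v : (v < n)%N -> exists2 i, (i < n)%N & roabp_order A i = v.
  move=> hv; exists (((Defs.order A)^-1)%g (Ordinal hv)) => //.
  by rewrite roabp_orderE permKV.
have := main_ok (@roabp_order_lt _ _ _ A) (@roabp_order_lt _ _ _ B)
  (@roabp_order_inj _ _ _ A) (@roabp_order_inj _ _ _ B) onto hn (ltn0Sn d) hA hB m0.
rewrite -V1 // => H.
exists (10 + (T + 2))%N, (setv s1 0 (ivar s1 7)); split.
- by apply: ExecSeq E0 _; apply: ExecSeq E1 _; exact: ExecISet.
- rewrite /output setv_same.
  by case: (roabp_poly_eq hA hB dA dB) H => E [[-> H]|[-> H]].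
have h1 : (10 + (T + 2) <= c * M.+1 ^ c)%N by apply: leq_trans (Hc M); lia.
apply: leq_trans h1 _; rewrite -mulnA leq_mul2l; apply/orP; right.
apply: (@leq_trans ((2 * M) ^ c)); first by case: (c) => // c'; rewrite leq_exp2r // /M; lia.
rewrite expnMn leq_mul2l; apply/orP; right.
by rewrite leq_pexp2l // leq_pmulr // expn_gt0.
Qed.
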